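(* Consider the $M$-lock, $n$-agent acquisition game described in the context. For every agent $i$ and every strategy profile $\pi^{-i}=(\pi^m)_{m\neq i}$ of the opponents, there exists an $M$-thresholds strategy (MT-strategy) $\pi^{i*}$ of agent $i$, given by thresholds $(\theta_1,\dots,\theta_M)\in[0,T]^M$, that is a best response to $\pi^{-i}$, i.e. $\phi^i(\pi^{i*},\pi^{-i})=\sup_{\pi^i\in S^i}\phi^i(\pi^i,\pi^{-i})$, where the supremum is over all strategies of agent $i$.
   Context: Data: number of agents $n$, number of locks $M\ge 1$, deadline $T>0$, trade-off factor $\nu>0$, maximal rates $\beta^i>0$, and rewards $c^i_k$ ($1\le i\le n$, $1\le k\le M$). Rate functions: for $0\le \tau\le T$, $L^\infty[\tau,T]$ (for agent $i$) denotes the set of measurable functions $a:[\tau,T]\to[0,\beta^i]$, and $\bar a(t)=\int_\tau^t a(s)\,ds$. States: the state of agent $i$ at its $k$-th decision epoch is $z=(l,\tau)$, where $l\in\{0,1\}$ ($1$ means all contacts so far were successful) and $\tau=\tau^i_{k-1}$ is the time of its $(k-1)$-th contact. The initial state is $z^i_1=(1,0)$. Strategies: a strategy $\pi^i\in S^i$ is a collection of rate functions $a^i_k(\cdot\,;z)\in L^\infty[\tau,T]$, one for each $k\in\{1,\dots,M\}$ and each state $z=(l,\tau)$ (depending measurably on $z$, so that the expectations below are defined). Failure probability of opponents: $\eta^i_1(t;\pi^{-i})=\exp\big(-\sum_{m\ne i}\bar a^m_1(t)\big)$, where $a^m_1=a^m_1(\cdot\,;(1,0))$, and $\eta^i_k\equiv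 1$ for $k>1$. Dynamics: in state $z^i_k=(1,\tau^i_{k-1})$ with $\tau^i_{k-1}<T$, using $a=a^i_k(\cdot\,;z^i_k)$, the next contact time $\tau^i_k$ satisfies $P(\tau^i_k>t)=e^{-\bar a(t)}$ for $t\in[\tau^i_{k-1},T]$ (no contact before $T$ means $\tau_k^i>T$, and no further rewards or costs). Given contact at time $s\le T$, the contact is successful ($z^i_{k+1}=(1,s)$) with probability $\eta^i_k(s;\pi^{-i})$, and otherwise $z^i_{k+1}=(0,s)$. Stage utility: $r^i_k(z^i_k,a;\pi^{-i})=c^i_k\int_{\tau^i_{k-1}}^T\eta^i_k(s;\pi^{-i})e^{-\bar a(s)}a(s)\,ds-\nu\Big(\bar a(T)e^{-\bar a(T)}+\int_{\tau^i_{k-1}}^T\bar a(s)e^{-\bar a(s)}a(s)\,ds\Big)$ if $z_k^i=(1,\tau^i_{k-1})$ with $\tau^i_{k-1}<T$, and $r^i_k=0$ otherwise. Total utility: $\phi^i(\pi^i,\pi^{-i})=\sum_{k=1}^M E[r^i_k(z^i_k,a^i_k;\pi^{-i})\mid z^i_1=(1,0)]$. Threshold policy: $\Gamma_{\theta;s}:[s,T]\to[0,\beta^i]$, with $0\le\theta\le T$, is given by $\Gamma_{\theta;s}(t)=\beta^i$ if $t\le\theta$ and $0$ otherwise (identically zero if $s>\theta$). MT-strategy: a strategy for which there are constants $\theta_1,\dots,\theta_M\in[0,T]$ such that, for every $k$, $a_k(\cdot\,;(1,s))=\Gamma_{\theta_k;s}$ for all $s$ (the threshold for lock $k$ does not depend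 on the time $s$ of acquisition of the previous lock), and $a_k(\cdot\,;(0,s))\equiv 0$ for all $s$. *)

(* Defs.v *)
From HB Require Import structures.
From mathcomp Require Import all_boot all_order all_algebra.
From mathcomp Require Import all_classical all_reals all_analysis.
From mathcomp Require Import measurable_realfun ring lra.
Set Implicit Arguments.
Unset Strict Implicit.
Unset Printing Implicit Defensive.
Import Order.TTheory GRing.Theory Num.Theory.
Import numFieldNormedType.Exports.
Local Open Scope classical_set_scope.
Local Open Scope ring_scope.

Record game (R : realType) := Game {
  agents : nat;
  locks : nat;
  deadline : R;
  tradeoff : R;
  maxrate : 'I_agents -> R;
  reward : 'I_agents -> 'I_locks -> R;
  locks_gt0 : (0 < locks)%N;
  deadline_gt0 : 0 < deadline;
  tradeoff_gt0 : 0 < tradeoff;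
  maxrate_gt0 : forall i, 0 < maxrate i
}.

(* [cumrate a s t] is the cumulative rate over [s, t], written \bar a(t) when
   the starting time s is clear. *)
Definition cumrate {R : realType} (a : R -> R) (s t : R) : R :=
  \int[lebesgue_measure]_(x in `[s, t]) a x.

(* Lock k is indexed by the ordinal k - 1.  [rate k l s t] is a_k(t; (l, s));
   only its values for 0 <= s <= t <= T are meaningful.  Measurability is
   required jointly in (s, t). *)
Record strategy (R : realType) (G : game R) (i : 'I_(agents G)) := Strategy {
  rate : 'I_(locks G) -> bool -> R -> R -> R;
  rate_bounds : forall k l (s t : R), 0 <= s -> s <= t -> t <= deadline G ->
    0 <= rate k l s t <= maxrate i;
  rate_measurable : forall k l,
    measurable_fun [set x : R * R | [/\ 0 <= x.1, x.1 <= x.2 & x.2 <= deadline G]]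
      (fun x => rate k l x.1 x.2)
}.

Lemma quadratic_aux (R : realFieldType) (e D q I : R) :
  0 <= e -> e <= 1 -> 0 <= D -> 1 - D <= q -> q <= 1 -> (1 + D) * q <= 1 ->
  e * q * D <= I -> I <= e * D -> `|I - (e - e * q)| <= D ^+ 2.
Proof.
move=> e0 e1 D0 q0 q1 Dq Il Iu.
have H1 : e * (1 - q) <= e * D by rewrite ler_wpM2l//; lra.
have H2 : e * (q * D) <= e * (1 - q) by rewrite ler_wpM2l//; lra.
have H3 : e * (D * (1 - q)) <= 1 * (D * D).
  apply: ler_pM => //; first by rewrite mulr_ge0//; lra.
  by rewrite ler_wpM2l//; lra.
by rewrite ler_norml expr2; apply/andP; split; lra.
Qed.

Section cumulative_rate.
Context {R : realType}.
Notation mu := (@lebesgue_measure R).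
Variables (T B : R) (a : R -> R -> R).
Hypothesis a_bounds : forall s t : R, 0 <= s -> s <= t -> t <= T -> 0 <= a s t <= B.
Hypothesis a_meas :
  measurable_fun [set x : R * R | [/\ 0 <= x.1, x.1 <= x.2 & x.2 <= T]]
    (fun x => a x.1 x.2).

Let tri : set (R * R) := [set x | [/\ 0 <= x.1, x.1 <= x.2 & x.2 <= T]].
Let a0 : R * R -> R := (fun x => a x.1 x.2) \_ tri.

Let mtri : measurable tri.
Proof.
rewrite (_ : tri = (fun x : R * R =>
   [&& 0 <= x.1, x.1 <= x.2 & x.2 <= T]) @^-1` [set true]); last first.
  by apply/seteqP; split => x /=; [move=> [-> -> ->]|move=> /and3P].
rewrite -[X in measurable X]setTI.
have : measurable_fun setT (fun x : R * R =>
   [&& 0 <= x.1, x.1 <= x.2 & x.2 <= T]).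
  by apply: measurable_and; [exact: measurable_fun_ler|
    apply: measurable_and; exact: measurable_fun_ler].
exact.
Qed.

Let ma0 : measurable_fun setT a0.
Proof. by apply/(measurable_restrict _ _ _).1 => //; rewrite setTI. Qed.

Let a0_ge0 x : 0 <= a0 x.
Proof.
rewrite /a0 patchE; case: ifPn => // /set_mem[h1 h2 h3].
by have /andP[] := a_bounds h1 h2 h3.
Qed.

Let a0E (s t : R) : 0 <= s -> s <= t -> t <= T -> a0 (s, t) = a s t.
Proof. by move=> s0 st tT; rewrite /a0 patchE mem_set//. Qed.

Lemma rate_section_measurable (s u v : R) : 0 <= s -> s <= u -> v <= T ->
  measurable_fun `[u, v] (a s).
Proof.
move=> s0 su vT; apply: (eq_measurable_fun (fun t => a0 (s, t))).
  move=> x; rewrite inE/= in_itv/= => /andP[sx xt].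
  by rewrite a0E// ?(le_trans su)// (le_trans xt).
apply: measurable_funTS.
by apply: measurableT_comp => //; exact: pair1_measurable.
Qed.


Let leb_itv (u v : R) : (mu `[u, v] < +oo)%E.
Proof. by rewrite lebesgue_measure_itv/=; case: ifP; rewrite ltry. Qed.

Let leb_itvE (u v : R) : u <= v -> fine (mu `[u, v]) = v - u.
Proof.
rewrite lebesgue_measure_itv/= lte_fin le_eqVlt => /predU1P[->|->//].
by rewrite ltxx subrr.
Qed.

Let bounded_integrable (f : R -> R) (u v c : R) :
  measurable_fun `[u, v] f -> (forall x, u <= x -> x <= v -> 0 <= f x <= c) ->
  mu.-integrable `[u, v] (EFin \o f).
Proof.
move=> mf fb; apply: measurable_bounded_integrable => //; first exact: leb_itv.
exists `|c|; split => // M cM x /=; rewrite in_itv/= => /andP[ux xv].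
have /andP[h1 h2] := fb _ ux xv.
by rewrite ger0_norm// (le_trans h2)// (le_trans (ler_norm _))// ltW.
Qed.

Lemma rate_section_integrable (s u v : R) : 0 <= s -> s <= u -> v <= T ->
  mu.-integrable `[u, v] (EFin \o a s).
Proof.
move=> s0 su vT; apply: (@bounded_integrable _ _ _ B).
  exact: rate_section_measurable.
by move=> x ux xv; rewrite a_bounds// ?(le_trans su)// (le_trans xv).
Qed.

Let itv_split (f : R -> R) (u v w : R) : u <= v -> v <= w ->
  mu.-integrable `[u, w] (EFin \o f) ->
  \int[mu]_(x in `[u, w]) f x =
  \int[mu]_(x in `[u, v]) f x + \int[mu]_(x in `[v, w]) f x.
Proof.
move=> uv vw fi; rewrite -(@Rintegral_itv_obnd_cbnd _ v).
  by rewrite -(@Rintegral_itvB _ f (BLeft u) (BRight w) v) ?bnd_simp// addrC subrK.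
apply: (integrableS _ _ _ fi) => //.
by apply: subset_itv; rewrite ?bnd_simp.
Qed.

Let itv_bounds (f : R -> R) (u v c d : R) : u <= v ->
  mu.-integrable `[u, v] (EFin \o f) ->
  (forall x, u <= x -> x <= v -> c <= f x <= d) ->
  c * (v - u) <= \int[mu]_(x in `[u, v]) f x <= d * (v - u).
Proof.
move=> uv fi fb; rewrite -leb_itvE//.
rewrite -!(Rintegral_cst mu)//.
have ki k : mu.-integrable `[u, v] (EFin \o (fun=> k : R)).
  apply: measurable_bounded_integrable => //; first exact: leb_itv.
  by exists `|k|; split => // M kM x _ /=; rewrite ltW.
apply/andP; split; apply: le_Rintegral => // x /=; rewrite in_itv/= => /andP[? ?].
- by have /andP[] := fb x ltac:(assumption) ltac:(assumption).
- by have /andP[] := fb x ltac:(assumption) ltac:(assumption).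
Qed.

Lemma cumrate_split (s u v : R) : 0 <= s -> s <= u -> u <= v -> v <= T ->
  cumrate (a s) s v = cumrate (a s) s u + \int[mu]_(x in `[u, v]) a s x.
Proof.
by move=> s0 su uv vT; apply: itv_split => //; exact: rate_section_integrable.
Qed.

Lemma rate_increment_bounds (s u v : R) : 0 <= s -> s <= u -> u <= v -> v <= T ->
  0 <= \int[mu]_(x in `[u, v]) a s x <= B * (v - u).
Proof.
move=> s0 su uv vT.
have := @itv_bounds (a s) u v 0 B uv (rate_section_integrable s0 su vT).
rewrite mul0r; apply => x ux xv.
by rewrite a_bounds// ?(le_trans su)// (le_trans xv).
Qed.

Lemma cumrate_ge0 (s t : R) : 0 <= s -> s <= t -> t <= T -> 0 <= cumrate (a s) s t.
Proof. by move=> s0 st tT; have /andP[] := rate_increment_bounds s0 (lexx s) st tT. Qed.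

Let cum (x : R * R) : R := fine (\int[mu]_r
  ((fun y : R * R * R => (if y.2 <= y.1.2 then a0 (y.1.1, y.2) else 0)%:E) (x, r)))%E.

Let mcum : measurable_fun setT cum.
Proof.
apply: measurableT_comp => //.
apply: (measurable_fun_fubini_tonelli_F (T1 := (R * R)%type)
  (T2 := measurableTypeR R) (m2 := mu)
  (fun y : R * R * R => (if y.2 <= y.1.2 then a0 (y.1.1, y.2) else 0)%:E)).
  apply/measurable_EFinP; apply: measurable_fun_ifT => //.
    by apply: measurable_fun_ler => //; exact: measurableT_comp.
  apply: measurableT_comp => //.
  by apply/measurable_fun_pair => //; exact: measurableT_comp.
by move=> x; rewrite lee_fin; case: ifP.
Qed.

Let cumE (s t : R) : 0 <= s -> s <= t -> t <= T -> cum (s, t) = cumrate (a s) s t.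
Proof.
move=> s0 st tT; rewrite /cum /cumrate /Rintegral; congr fine.
rewrite [RHS]integral_mkcond; apply: eq_integral => r _ /=.
rewrite patchE; case: ifPn => [rt|]; case: ifPn => //.
- by rewrite inE/= in_itv/= => /andP[sr _]; rewrite a0E// (le_trans rt).
- rewrite notin_setE/= in_itv/= rt andbT => sr.
  rewrite /a0 patchE memNset// => -[/= _ sr1 _]. exact: (sr sr1).
- by move=> /[swap]; rewrite -ltNge => tr H; have := set_mem H; rewrite /= in_itv/= => /andP[_ ]; rewrite leNgt tr.
Qed.

Lemma cumrate_measurable :
  measurable_fun [set x : R * R | [/\ 0 <= x.1, x.1 <= x.2 & x.2 <= T]]
    (fun x => cumrate (a x.1) x.1 x.2).
Proof.
apply: (eq_measurable_fun cum); last exact: measurable_funTS.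
by move=> [s t]; rewrite inE => -[/= h1 h2 h3]; rewrite cumE.
Qed.

Definition contact_density (s t : R) : R := a s t * expR (- cumrate (a s) s t).

Lemma contact_density_bounds (s t : R) : 0 <= s -> s <= t -> t <= T ->
  0 <= contact_density s t <= B.
Proof.
move=> s0 st tT; have /andP[h1 h2] := a_bounds s0 st tT.
rewrite mulr_ge0 ?expR_ge0//= (le_trans _ h2)// ler_piMr// -expR0 ler_expR.
by rewrite oppr_le0 cumrate_ge0.
Qed.

Let den : R * R -> R := (fun x => contact_density x.1 x.2) \_ tri.

Let mden : measurable_fun setT den.
Proof.
apply/(measurable_restrict _ _ _).1 => //; rewrite setTI.
apply: measurable_funM => //; apply: measurableT_comp => //.
by apply: measurableT_comp => //; exact: cumrate_measurable.
Qed.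

Let denE (s t : R) : 0 <= s -> s <= t -> t <= T -> den (s, t) = contact_density s t.
Proof. by move=> s0 st tT; rewrite /den patchE mem_set//. Qed.

Let den_ge0 x : 0 <= den x.
Proof.
rewrite /den patchE; case: ifPn => // /set_mem[h1 h2 h3].
by have /andP[] := contact_density_bounds h1 h2 h3.
Qed.

Lemma contact_density_measurable (s u v : R) : 0 <= s -> s <= u -> v <= T ->
  measurable_fun `[u, v] (contact_density s).
Proof.
move=> s0 su vT; apply: (eq_measurable_fun (fun t => den (s, t))).
  move=> x; rewrite inE/= in_itv/= => /andP[sx xt].
  by rewrite denE// ?(le_trans su)// (le_trans xt).
apply: measurable_funTS.
by apply: measurableT_comp => //; exact: pair1_measurable.
Qed.

Lemma contact_density_integrable (s u v : R) : 0 <= s -> s <= u -> v <= T ->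
  mu.-integrable `[u, v] (EFin \o contact_density s).
Proof.
move=> s0 su vT; apply: (@bounded_integrable _ _ _ B).
  exact: contact_density_measurable.
by move=> x ux xv; rewrite contact_density_bounds// ?(le_trans su)// (le_trans xv).
Qed.

Let quadratic_increment (s u v : R) : 0 <= s -> s <= u -> u <= v -> v <= T ->
  `| \int[mu]_(x in `[u, v]) contact_density s x
     - (expR (- cumrate (a s) s u) - expR (- cumrate (a s) s v)) |
  <= (B * (v - u)) ^+ 2.
Proof.
move=> s0 su uv vT.
have uT := le_trans uv vT.
set D := \int[mu]_(x in `[u, v]) a s x.
have /andP[D0 DB] := rate_increment_bounds s0 su uv vT.
have cv : cumrate (a s) s v = cumrate (a s) s u + D by exact: cumrate_split.
have cu0 := cumrate_ge0 s0 su uT.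
set e := expR (- cumrate (a s) s u).
have e1 : e <= 1 by rewrite /e -expR0 ler_expR oppr_le0.
have e0 : 0 <= e by exact: expR_ge0.
have cvE : expR (- cumrate (a s) s v) = e * expR (- D).
  by rewrite cv opprD expRD.
rewrite cvE.
have eD0 : 1 - D <= expR (- D) by exact: expR_ge1Dx.
have eD1 : expR (- D) <= 1 by rewrite -expR0 ler_expR oppr_le0.
have ai := rate_section_integrable s0 su vT.
have di := contact_density_integrable s0 su vT.
have pt (x : R) : u <= x -> x <= v ->
    expR (- cumrate (a s) s v) * a s x <= contact_density s x <= e * a s x.
  move=> ux xv; have sx := le_trans su ux; have xT := le_trans xv vT.
  have /andP[a1 _] := a_bounds s0 sx xT.
  rewrite /contact_density (mulrC (a s x)).
  have /andP[i1 _] := rate_increment_bounds s0 su ux xT.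
  have /andP[i2 _] := rate_increment_bounds s0 sx xv vT.
  apply/andP; split; apply: (ler_wpM2r a1); rewrite ler_expR lerN2.
    by rewrite (cumrate_split s0 sx xv vT) lerDl.
  by rewrite (cumrate_split s0 su ux xT) lerDl.
have Hu : \int[mu]_(x in `[u, v]) contact_density s x <= e * D.
  rewrite -RintegralZl//; apply: le_Rintegral => //.
    exact: (integrableZl _ _ ai).
  by move=> x /=; rewrite in_itv/= => /andP[ux xv]; have /andP[] := pt x ux xv.
have Hl : e * expR (- D) * D <= \int[mu]_(x in `[u, v]) contact_density s x.
  rewrite -cvE -RintegralZl//; apply: le_Rintegral => //.
    exact: (integrableZl _ _ ai).
  by move=> x /=; rewrite in_itv/= => /andP[ux xv]; have /andP[] := pt x ux xv.
set I := \int[mu]_(x in _) contact_density s x in Hu Hl *.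
have [E0 E1] : 0 < expR D /\ expR D * expR (- D) = 1.
  by rewrite expR_gt0 expRxMexpNx_1.
apply: (le_trans (quadratic_aux e0 e1 D0 eD0 eD1 _ Hl Hu)).
  rewrite -[leRHS]E1; apply: ler_wpM2r; [exact: expR_ge0|exact: expR_ge1Dx].
have BD0 : 0 <= B * (v - u) by exact: le_trans DB.
by rewrite !expr2; apply: ler_pM.
Qed.

Lemma cumrate_section_measurable (s : R) : 0 <= s ->
  measurable_fun `[s, T] (cumrate (a s) s).
Proof.
move=> s0; apply: (eq_measurable_fun (fun t => cum (s, t))).
  by move=> t; rewrite inE/= in_itv/= => /andP[st tT]; rewrite cumE.
apply: measurable_funTS.
by apply: measurableT_comp => //; exact: pair1_measurable.
Qed.

Lemma contact_density_integral (s t : R) : 0 <= s -> s <= t -> t <= T ->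
  \int[mu]_(x in `[s, t]) contact_density s x = 1 - expR (- cumrate (a s) s t).
Proof.
move=> s0 st tT.
pose F u := \int[mu]_(x in `[s, u]) contact_density s x
            - (1 - expR (- cumrate (a s) s u)).
have Fs : F s = 0.
  by rewrite /F /cumrate set_itv1 !Rintegral_set1 oppr0 expR0 !subrr.
have FD u v : s <= u -> u <= v -> v <= t -> `|F v - F u| <= (B * (v - u)) ^+ 2.
  move=> su uv vt; have vT := le_trans vt tT.
  have := quadratic_increment s0 su uv vT.
  congr (`| _ | <= _); rewrite /F (@itv_split _ s u v)//.
    set p := expR _; set q := expR _; set m := \int[mu]_(x in `[s, u]) _.
    by set n := Rintegral _ _ _; move: p q m n => p q m n; ring.
  exact: contact_density_integrable.
suff : F t = 0 by move/eqP; rewrite subr_eq0 => /eqP.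
apply/eqP; rewrite -normr_eq0 eq_le normr_ge0 andbT.
apply/ler_addgt0Pl => eps eps0; rewrite addr0.
pose K := (B * (t - s)) ^+ 2.
have K0 : 0 <= K by exact: sqr_ge0.
pose N := (Num.Def.archi_bound (K / eps)).+1.
have HN : K / N%:R <= eps.
  rewrite ler_pdivrMr ?ltr0n// mulrC -ler_pdivrMr//.
  have /ltW/le_trans := archi_boundP (divr_ge0 K0 (ltW eps0)); apply.
  by rewrite ler_nat.
pose h := (t - s) / N%:R.
have h0 : 0 <= h by rewrite divr_ge0// subr_ge0.
have Nh : N%:R * h = t - s by rewrite mulrC divfK// pnatr_eq0.
have step n : (n <= N)%N -> `|F (s + n%:R * h)| <= n%:R * (B * h) ^+ 2.
  elim: n => [_|n IH nN]; first by rewrite !mul0r addr0 Fs normr0.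
  have /IH {}IH : (n <= N)%N by exact: ltnW.
  have le1 : s <= s + n%:R * h by rewrite lerDl mulr_ge0.
  have le2 : s + n%:R * h <= s + n.+1%:R * h.
    by rewrite lerD2l ler_wpM2r// ler_nat.
  have le3 : s + n.+1%:R * h <= t.
    rewrite -lerBrDl -Nh ler_wpM2r// ler_nat//.
  have := FD _ _ le1 le2 le3.
  rewrite (_ : s + n.+1%:R * h - (s + n%:R * h) = h); last first.
    by rewrite -natr1; ring.
  move=> H; rewrite -[X in `|X|](subrK (F (s + n%:R * h))).
  apply: (le_trans (ler_normD _ _)).
  have -> : n.+1%:R * (B * h) ^+ 2 = (B * h) ^+ 2 + n%:R * (B * h) ^+ 2.
    by rewrite -natr1; ring.
  exact: lerD.
have := step N (leqnn N); rewrite Nh addrC subrK => /le_trans; apply.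
apply: le_trans HN; rewrite /K le_eqVlt; apply/orP; left; apply/eqP.
by rewrite /h; field; rewrite pnatr_eq0.
Qed.

(* The law of the next contact time, started at s: it has density
   [contact_density s] on [s, T], and an atom at +oo (no contact before T).
   It is characterized by [contact_law_survival]. *)
Definition contact_law (s : R) (A : set \bar R) : \bar R :=
  (\int[mu]_(t in `[s, T] `&` EFin @^-1` A) (contact_density s t)%:E
   + (expR (- cumrate (a s) s T))%:E * \d_(+oo%E : \bar R) A)%E.

Let mEFinpre (A : set \bar R) : measurable A -> measurable (EFin @^-1` A : set R).
Proof.
move=> mA; rewrite -[X in measurable X]setTI.
by apply: EFin_measurable.
Qed.

Lemma contact_law0 (s : R) : contact_law s set0 = 0%E.
Proof. by rewrite /contact_law preimage_set0 setI0 integral_set0 measure0 mule0 adde0. Qed.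

Lemma contact_law_ge0 (s : R) A : 0 <= s -> (0 <= contact_law s A)%E.
Proof.
move=> s0; rewrite adde_ge0 ?mule_ge0 ?lee_fin ?expR_ge0//.
apply: integral_ge0 => t [/=]; rewrite in_itv/= => /andP[st tT] _.
by rewrite lee_fin; have /andP[] := contact_density_bounds s0 st tT.
Qed.

Lemma contact_law_sigma_additive (s : R) : 0 <= s ->
  semi_sigma_additive (contact_law s).
Proof.
move=> s0 /= F mF tF mUF.
have c0 k : (0 <= contact_law s (F k))%E by exact: contact_law_ge0.
apply: cvg_toP.
  by apply: ereal_nondecreasing_is_cvgn => m n mn; exact: lee_sum_nneg_natr.
rewrite /contact_law nneseriesD; last 2 first.
- move=> k _ _; apply: integral_ge0 => t [/=]; rewrite in_itv/= => /andP[st tT] _.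
  by rewrite lee_fin; have /andP[] := contact_density_bounds s0 st tT.
- by move=> k _ _; rewrite mule_ge0// lee_fin expR_ge0.
rewrite nneseriesZl//; congr (_ + _ * _)%E; last first.
  by apply/cvg_lim => //; exact: measure_semi_sigma_additive.
rewrite preimage_bigcup setI_bigcupr ge0_integral_bigcup//.
- by move=> k; apply: measurableI => //; exact: mEFinpre.
- apply/measurable_EFinP; apply: (measurable_funS (E := `[s, T]%classic)) => //.
    by move=> x [k _ []].
  exact: contact_density_measurable.
- move=> t [k _ [/=]]; rewrite in_itv/= => /andP[st tT] _.
  by rewrite lee_fin; have /andP[] := contact_density_bounds s0 st tT.
- apply/trivIsetP => i j _ _ ij; move/trivIsetP : tF => /(_ i j Logic.I Logic.I ij) Fij.
  by rewrite setIACA setIid -preimage_setI Fij preimage_set0 setI0.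
Qed.

Lemma contact_law_survival (s t : R) : 0 <= s -> s <= t -> t <= T ->
  contact_law s [set x | (t%:E < x)%E] = (expR (- cumrate (a s) s t))%:E.
Proof.
move=> s0 st tT.
rewrite /contact_law diracE mem_set/= ?ltry// mule1.
have sT := le_trans st tT.
rewrite (_ : _ `&` _ = `]t, T]%classic); last first.
  apply/seteqP; split => x /=; rewrite !in_itv/= lte_fin.
    by move=> [/andP[_ ->] ->].
  by move=> /andP[tx ->]; rewrite tx (le_trans st (ltW tx)).
have di := contact_density_integrable s0 (lexx s) (lexx T).
have di' : mu.-integrable `]t, T] (EFin \o contact_density s).
  by apply: (integrableS _ _ _ di) => //; apply: subset_itv; rewrite ?bnd_simp.
rewrite -[X in (X + _)%E]fineK ?integrable_fin_num//.
rewrite -[fine _]/(Rintegral _ _ _) -(@Rintegral_itvB _ _ (BLeft s) (BRight T) t) ?bnd_simp//.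
rewrite !contact_density_integral// -EFinD; congr EFin.
by move: (expR _) (expR _) => p q; ring.
Qed.

Lemma contact_lawT (s : R) : 0 <= s -> s <= T -> contact_law s setT = 1%E.
Proof.
move=> s0 sT; rewrite /contact_law diracT mule1 preimage_setT setIT.
rewrite -[X in (X + _)%E]fineK; last first.
  apply: integrable_fin_num => //.
  exact: contact_density_integrable.
rewrite -[fine _]/(Rintegral _ _ _) contact_density_integral// -EFinD.
by rewrite subrK.
Qed.

Lemma contact_law_measurable A : measurable A ->
  measurable_fun [set s | 0 <= s <= T] (contact_law ^~ A).
Proof.
move=> mA.
have mD : measurable [set s : R | 0 <= s <= T].
  rewrite (_ : [set _ | _] = `[0, T]%classic)//.
apply: emeasurable_funD.
  apply: (eq_measurable_fun (fun s => \int[mu]_t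
     ((fun y : R * R => (den y * \1_(EFin @^-1` A) y.2)%:E) (s, t)))%E).
    move=> s; rewrite inE/= => /andP[s0 sT].
    rewrite [RHS]integral_mkcond; apply: eq_integral => t _ /=.
    rewrite patchE indicE; case: ifPn; last first.
      rewrite notin_setE/= in_itv/= => H; case: (boolP (t \in _)) => tA; last by rewrite mulr0.
      rewrite /den patchE memNset ?mul0r//= => -[/= _ h1 h2]; apply: H.
      by split; [rewrite h1|exact: set_mem].
    rewrite inE => -[]/=; rewrite in_itv/= => /andP[st tT] tA.
    by rewrite mem_set//= mulr1 denE.
  apply: measurable_funTS.
  apply: (measurable_fun_fubini_tonelli_F (T1 := R)
    (T2 := measurableTypeR R) (m2 := mu)
    (fun y : R * R => (den y * \1_(EFin @^-1` A) y.2)%:E)).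
    apply/measurable_EFinP; apply: measurable_funM => //.
    apply: measurableT_comp => //.
    by apply: measurable_indic; exact: mEFinpre.
  by move=> x; rewrite lee_fin mulr_ge0.
apply: emeasurable_funM => //.
apply/measurable_EFinP; apply: measurableT_comp => //.
apply: measurableT_comp => //.
apply: (eq_measurable_fun (fun s => cum (s, T))).
  by move=> s; rewrite inE/= => /andP[s0 sT]; rewrite cumE.
by apply: measurable_funTS; exact: measurableT_comp.
Qed.

End cumulative_rate.

(* The state (l, tau): l = true when all contacts so far were successful, tau
   is the time of the last contact, +oo when no contact occurred before T. *)
Definition state (R : realType) : measurableType _ := (bool * \bar R)%type.

Section play.
Context {R : realType} {G : game R} {i : 'I_(agents G)}.
Notation T := (deadline G).
Notation mu := (@lebesgue_measure R).

Definition opponents := forall m : {m : 'I_(agents G) | m != i}, strategy (val m).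

Definition lock1 : 'I_(locks G) := Ordinal (locks_gt0 G).

(* The probability eta_k(t) that a contact of lock k at time t succeeds. *)
Definition eta (piO : opponents) (k : 'I_(locks G)) (t : R) : R :=
  if k == lock1 then
    expR (- \sum_m cumrate (rate (piO m) lock1 true 0) 0 t)
  else 1.

Lemma eta_bounds piO k t : 0 <= t <= T -> 0 <= eta piO k t <= 1.
Proof.
move=> /andP[t0 tT]; rewrite /eta; case: ifP => _; last by rewrite ler01 lexx.
rewrite expR_ge0 -expR0 ler_expR oppr_le0; apply: sumr_ge0 => m _.
exact (cumrate_ge0 (rate_bounds (piO m) lock1 true)
  (rate_measurable (piO m) lock1 true) (lexx 0) t0 tT).
Qed.

Definition running (z : state R) : bool := (0 <= z.2 < T%:E)%E.

Section transition.
Variables (pi : strategy i) (piO : opponents) (k : 'I_(locks G)).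

Definition contact (z : state R) (A : set \bar R) : \bar R :=
  if running z then contact_law T (rate pi k z.1) (fine z.2) A
  else \d_(+oo%E : \bar R) A.

Let running_fine (z : state R) : running z -> 0 <= fine z.2 /\ fine z.2 <= T.
Proof.
case: z => l [r| |] /andP[h1 h2].
- by move: h1 h2; rewrite /= lee_fin lte_fin => -> /ltW.
- by move: h2; rewrite ltNge leey.
- by move: h1; rewrite leNgt ltNy0.
Qed.

Let contact0 z : contact z set0 = 0%E.
Proof. by rewrite /contact contact_law0 measure0 if_same. Qed.

Let contact_ge0 z A : (0 <= contact z A)%E.
Proof.
rewrite /contact; case: ifPn => // /running_fine[h1 h2].
exact (contact_law_ge0 (rate_bounds pi k z.1) (rate_measurable pi k z.1) A h1).
Qed.

Let contact_sigma_additive z : semi_sigma_additive (contact z).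
Proof.
rewrite (_ : contact z = if running z
    then contact_law T (rate pi k z.1) (fine z.2) else \d_(+oo%E : \bar R)); last first.
  by apply/funext => A; rewrite /contact; case: ifP.
case: ifP => [/running_fine[h1 h2]|_].
  exact (contact_law_sigma_additive (rate_bounds pi k z.1) (rate_measurable pi k z.1) h1).
exact: measure_semi_sigma_additive.
Qed.

HB.instance Definition _ z := isMeasure.Build _ _ R (contact z)
  (contact0 z) (contact_ge0 z) (@contact_sigma_additive z).

Definition contact_kernel : state R -> {measure set (\bar R) -> \bar R} := contact.

Let measurable_running : measurable_fun setT running.
Proof.
by apply: measurable_and; [exact: measurable_fun_lee|exact: measurable_fun_lte].
Qed.

Let measurable_contact A : measurable A ->
  measurable_fun setT (contact_kernel ^~ A).
Proof.
move=> mA; rewrite /contact_kernel/= /contact.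
apply: measurable_fun_if => //.
rewrite setTI.
have mr : measurable (running @^-1` [set true] : set (state R)).
  by rewrite -[X in measurable X]setTI; exact: measurable_running.
have ml (b : bool) : measurable_fun [set s | 0 <= s <= T]
    (fun s => contact_law T (rate pi k b) s A).
  exact (contact_law_measurable (rate_bounds pi k b) (rate_measurable pi k b) mA).
apply: (eq_measurable_fun (fun z : state R =>
  if z.1 then contact_law T (rate pi k true) (fine z.2) A
  else contact_law T (rate pi k false) (fine z.2) A)).
  by move=> [[] t].
have mD : measurable [set s : R | 0 <= s <= T].
  by rewrite (_ : [set _ | _] = `[0, T]%classic).
have mf b D : D `<=` running @^-1` [set true] -> measurable_fun D
    (fun z : state R => contact_law T (rate pi k b) (fine z.2) A).
  move=> DE.
  apply: (measurable_comp (F := [set s | 0 <= s <= T]) (g := fun z : state R => fine z.2) _ _ (ml b)) => //.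
    by move=> _ [z /DE /= /running_fine[h1 h2] <-]; rewrite h1.
  by apply: measurable_funTS; exact: measurableT_comp.
refine (measurable_fun_if mr (f := fun z : state R => z.1) _ _ _).
- by apply: measurable_funTS; exact: measurable_fst.
- by apply: mf => z [].
- by apply: mf => z [].
Qed.

HB.instance Definition _ := isKernel.Build _ _ _ _ R contact_kernel measurable_contact.

Let contact_kernelT z : contact_kernel z setT = 1%E.
Proof.
rewrite /contact_kernel/= /contact; case: ifPn => [/running_fine[h1 h2]|_].
  exact (contact_lawT (rate_bounds pi k z.1) (rate_measurable pi k z.1) h1 h2).
by rewrite diracT.
Qed.

HB.instance Definition _ := Kernel_isProbability.Build _ _ _ _ R contact_kernel contact_kernelT.

(* Success probability of a contact at time t; the value 1 outside [0, T] is
   immaterial. *)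
Definition success_prob (t : \bar R) : R :=
  if (0 <= t <= T%:E)%E then eta piO k (fine t) else 1.

Let measurable_success : measurable_fun setT
  (fun x : state R * \bar R => bernoulli_prob (success_prob x.2) : pprobability bool R).
Proof.
apply: (measurableT_comp measurable_bernoulli_prob).
apply: (@measurableT_comp _ _ _ _ _ _ success_prob) => //.
rewrite /success_prob /eta; case: (k == lock1); last first.
  by rewrite (_ : (fun _ => _) = cst 1)//; apply/funext => t; rewrite if_same.
apply: measurable_fun_if => //.
  by apply: measurable_and; exact: measurable_fun_lee.
apply: measurableT_comp => //; apply: measurableT_comp => //.
apply: measurable_sum => m.
rewrite setTI.
apply: (measurable_comp (F := `[0, T]%classic) (g := fine)
  (f := fun t => cumrate (rate (piO m) lock1 true 0) 0 t)) => //.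
- move=> _ [[r| |] h12 <-]; have /andP[h1 h2] := h12.
  + by rewrite /= in_itv/= -!lee_fin h1.
  + by move: h2; rewrite leNgt ltry.
  + by move: h1; rewrite leNgt ltNy0.
- exact (cumrate_section_measurable (rate_bounds (piO m) lock1 true)
    (rate_measurable (piO m) lock1 true) (lexx 0)).
- by apply: measurable_funTS.
Qed.

Definition success_kernel : state R * \bar R -> {measure set bool -> \bar R} :=
  kprobability measurable_success.

HB.instance Definition _ := ProbabilityKernel.on success_kernel.

Definition next_state (x : state R * \bar R * bool) : state R := (x.1.1.1 && x.2, x.1.2).

Lemma measurable_next_state : measurable_fun setT next_state.
Proof.
apply/measurable_fun_pair => //; last by apply: measurableT_comp.
by apply: measurable_and => //; do 2 apply: measurableT_comp => //.
Qed.

(* In state (l, tau), the next contact time t is drawn, then its success b with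
   probability [success_prob t]; the new state is (l && b, t).  Contacts keep
   occurring after a failure (l = false), where the stage utility is 0. *)
Definition transition : state R -> {measure set (state R) -> \bar R} :=
  (contact_kernel \; (success_kernel \; kdirac measurable_next_state))%E.

Let measurable_transition A : measurable A ->
  measurable_fun setT (transition ^~ A).
Proof. exact: measurable_kernel. Qed.

HB.instance Definition _ := isKernel.Build _ _ _ _ R transition
  measurable_transition.

Let transitionT z : transition z setT = 1%E.
Proof.
transitivity (\int[contact_kernel z]_t 1)%E.
  apply: eq_integral => t _ /=.
  transitivity (\int[success_kernel (z, t)]_b 1)%E.
    by apply: eq_integral => b _; rewrite /= /kdirac diracT.
  by rewrite integral_cst// mul1e prob_kernel.
by rewrite integral_cst// mul1e prob_kernel.
Qed.

HB.instance Definition _ := Kernel_isProbability.Build _ _ _ _ R transition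
  transitionT.

End transition.

Section utility.
Variables (pi : strategy i) (piO : opponents).

(* [chain n z] is the law of the state after n contact epochs, starting from z. *)
Fixpoint chain (n : nat) : R.-spker (state R) ~> (state R) :=
  if n is n'.+1 then
    if insub n' is Some k then mkcomp_noparam (chain n') (transition pi piO k)
    else chain n'
  else kdirac (@measurable_id _ (state R) setT).

Lemma chainT n z : chain n z setT = 1%E.
Proof.
elim: n => [|n IH] /=; first by rewrite /kdirac diracT.
case: insubP => [k _ _|//]; rewrite /= /kcomp_noparam.
by under eq_integral do rewrite prob_kernel; rewrite integral_cst// mul1e.
Qed.

Definition stage_utility (k : 'I_(locks G)) (z : state R) : R :=
  let tau := fine z.2 in
  let a := rate pi k z.1 tau in
  let abar := cumrate a tau in
  if z.1 && running z then
    reward i k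
      * \int[mu]_(s in `[tau, T]) (eta piO k s * expR (- abar s) * a s)
    - tradeoff G
      * (abar T * expR (- abar T)
         + \int[mu]_(s in `[tau, T]) (abar s * expR (- abar s) * a s))
  else 0.

Definition utility : \bar R :=
  (\sum_(k < locks G) \int[chain k (true, 0%:E)]_z (stage_utility k z)%:E)%E.

End utility.

(* On [s, T] the policy does not depend on s except through its domain. *)
Definition threshold_policy (theta t : R) : R :=
  if t <= theta then maxrate i else 0.

Definition is_MT_strategy (theta : 'I_(locks G) -> R) (pi : strategy i) : Prop :=
  (forall k, 0 <= theta k <= T) /\
  forall k (s t : R), 0 <= s -> s <= t -> t <= T ->
    rate pi k true s t = threshold_policy (theta k) t /\
    rate pi k false s t = 0.

End play.
Arguments opponents {R G} i.

(* Main.v *)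
(* Since abar exp(-abar) + int abar exp(-abar) a = int exp(-abar) a, the stage
   cost is nu times the probability of a contact.  With V_(k+1) the value of the
   later locks, agent i therefore maximizes the integral over [tau, T] of
   a exp(-abar) times the margin eta_k (c_k + V_(k+1)) - nu.  By backward
   induction V_(k+1) is nonnegative and nonincreasing, and so is eta_k; hence
   the positive part of the margin (the gain) is nonincreasing, and the margin
   stays nonpositive once it is.  Contacting at the full rate makes the contact
   time stochastically smallest, so by the layer cake formula the gain obtained
   at the full rate bounds the payoff of every rate function.  Stopping at the
   time where the margin changes sign, which does not depend on tau, attains
   this bound. *)
Require Import Defs.
From HB Require Import structures.
From mathcomp Require Import all_boot all_order all_algebra.
From mathcomp Require Import all_classical all_reals all_analysis.
From mathcomp Require Import measurable_realfun.
From mathcomp Require Import ring.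
Set Implicit Arguments.
Unset Strict Implicit.
Unset Printing Implicit Defensive.
Import Order.TTheory GRing.Theory Num.Theory.
Import numFieldNormedType.Exports.
Local Open Scope classical_set_scope.
Local Open Scope ring_scope.

(** * Comparison of integrals by dominance *)

Section dominance.
Context {R : realType}.
Notation mu := (@lebesgue_measure R).

Lemma integrable_bounded_itv (f : R -> R) (u v c : R) :
  measurable_fun `[u, v] f -> (forall x, u <= x -> x <= v -> `|f x| <= c) ->
  mu.-integrable `[u, v] (EFin \o f).
Proof.
move=> mf fb; apply: measurable_bounded_integrable => //.
  by have /= -> := @lebesgue_measure_itv R `[u, v]; case: ifP; rewrite ltry.
exists c; split; first exact: num_real.
move=> M cM x /=; rewrite in_itv/= => /andP[ux xv].
exact: (le_trans (fb _ ux xv) (ltW cM)).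
Qed.

Lemma nonincreasing_in_measurable (g : R -> R) (s T : R) :
  (forall x y, s <= x -> x <= y -> y <= T -> g y <= g x) ->
  measurable_fun `[s, T] g.
Proof.
move=> gni; have [sT|Ts] := leP s T; last first.
  by rewrite set_itv_ge ?bnd_simp -?ltNge//; exact: measurable_fun_set0.
(* Clamping the argument to [[s, T]] gives a function that is monotone on the whole line and agrees
   with [g] on the interval. *)
pose h x := g (Num.max s (Num.min x T)).
apply: (eq_measurable_fun h).
  move=> x; rewrite inE/= in_itv/= => /andP[sx xT].
  by rewrite /h (min_idPl xT) (max_idPr sx).
apply: nonincreasing_measurable => // x y xy; rewrite /h; apply: gni.
- by rewrite le_max lexx.
- by rewrite ge_max !le_max lexx/= le_min !ge_min xy lexx !orbT.
- by rewrite ge_max sT/= ge_min lexx orbT.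
Qed.

Variables (s T : R).

(** A superlevel set of a nonincreasing function is closed downwards in [[s, T]], so when nonempty
    it runs from [s] to its supremum, which may or may not belong to it. Hence comparing masses on
    initial segments suffices for dominance. *)
Let initial_segment (g : R -> R) (y : R) :
  (forall u v, s <= u -> u <= v -> v <= T -> g v <= g u) ->
  let A := [set x | s <= x <= T /\ y < g x] in
  A = set0 \/ exists2 u, s <= u <= T & A = `[s, u]%classic \/ A = `[s, u[%classic.
Proof.
move=> gni A; have [->|/set0P A0] := eqVneq A set0; first by left.
right; have ubT : ubound A T by move=> x [/andP[]].
have hA : has_sup A by split => //; exists T.
have sA x : A x -> x <= sup A by move=> Ax; apply: sup_upper_bound.
have Adown x z : A z -> s <= x -> x <= z -> A x.
  move=> [/andP[sz zT] yz] sx xz; split; first by rewrite sx (le_trans xz).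
  by rewrite (lt_le_trans yz)// gni.
exists (sup A).
  case: A0 => z Az; rewrite (@le_trans _ _ z) ?sA//=; last by case: Az => /andP[].
  by apply: sup_le_ub => //; exists z.
have [Au|Au] := pselect (A (sup A)); [left|right]; apply/seteqP; split => x /=; rewrite in_itv/=.
- by move=> Ax; rewrite sA// andbT; case: Ax => /andP[].
- by move=> /andP[sx xu]; exact: Adown Au _ _.
- move=> Ax; rewrite lt_neqAle sA//; case: (Ax) => /andP[-> _] _; rewrite andbT /=.
  by apply/eqP => xu; apply: Au; rewrite -xu.
- move=> /andP[sx xu]; have [z Az xz] := sup_gt A0 xu.
  exact: Adown Az sx (ltW xz).
Qed.

Let superlevel (g : R -> R) (y : R) := [set x | s <= x <= T /\ y < g x].

Section layer_cake.
Variables f g : R -> R.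
Hypothesis mf : measurable_fun `[s, T] f.
Hypothesis mg : measurable_fun `[s, T] g.
Hypothesis f0 : forall x, s <= x -> x <= T -> 0 <= f x.
Hypothesis g0 : forall x, s <= x -> x <= T -> 0 <= g x.

Let F := f \_ `[s, T].
Let G := g \_ `[s, T].
(** The weight [f] spread over the region under the graph of [g]. Integrating first in the level
    gives [g * f]; integrating first in time gives the mass of [f] on a superlevel set. *)
Let h (z : R * R) : \bar R := (if (0 <= z.2) && (z.2 < G z.1) then F z.1 else 0)%:E.

Let F0 x : 0 <= F x.
Proof.
by rewrite /F patchE; case: ifPn => // /set_mem/=; rewrite in_itv/= => /andP[]; exact: f0.
Qed.

Let mh : measurable_fun setT h.
Proof.
have mF : measurable_fun setT F by apply/(measurable_restrictT _ _).1.
have mG : measurable_fun setT G by apply/(measurable_restrictT _ _).1.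
apply/measurable_EFinP; apply: measurable_fun_ifT => //.
- apply: measurable_and; first exact: measurable_fun_ler.
  by apply: measurable_fun_ltr => //; exact: measurableT_comp.
- exact: measurableT_comp.
Qed.

Let h0 z : (0 <= h z)%E.
Proof. by rewrite lee_fin; case: ifP. Qed.

Let integral_h y : 0 <= y ->
  (\int[mu]_x h (x, y) = \int[mu]_(x in superlevel g y) (f x)%:E)%E.
Proof.
move=> y0; rewrite [RHS]integral_mkcond; apply: eq_integral => x _.
rewrite /h/= y0/= !patchE /F /G !patchE.
have [xs|xs] := boolP (x \in `[s, T]%classic).
  have := set_mem xs; rewrite /= in_itv/= => xsT.
  case: ifPn => yg; first by rewrite mem_set.
  by rewrite memNset//= => -[_]; apply/negP.
rewrite ltNge y0/= memNset//= => -[xsT _]; move: xs.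
by rewrite notin_setE/= in_itv/=.
Qed.

Lemma measurable_integral_superlevel : measurable_fun (`[0, +oo[%classic : set R)
  (fun y => \int[mu]_(x in superlevel g y) (f x)%:E)%E.
Proof.
apply: (eq_measurable_fun (fun y => \int[mu]_x h (x, y)))%E.
  by move=> y; rewrite inE/= in_itv/= andbT => /integral_h.
apply: measurable_funTS.
exact: (measurable_fun_fubini_tonelli_G (m1 := mu) (T1 := measurableTypeR R)).
Qed.

(** Tonelli for [h]: at fixed [x] the admissible levels form an interval of length [g x], on which
    [h] is constantly [f x]. *)
Lemma integral_layer_cake :
  (\int[mu]_(x in `[s, T]) (g x * f x)%:E =
   \int[mu]_(y in `[0%R, +oo[) \int[mu]_(x in superlevel g y) (f x)%:E)%E.
Proof.
transitivity (\int[mu]_x \int[mu]_y h (x, y))%E.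
  rewrite integral_mkcond; apply: eq_integral => x _ /=.
  transitivity (\int[mu]_(y in `[0%R, G x[) (F x)%:E)%E; last first.
    rewrite [LHS]integral_mkcond; apply: eq_integral => y _.
    rewrite patchE /h/=; case: ifPn => [|]; first by rewrite inE/= in_itv/= => ->.
    by rewrite notin_setE/= in_itv/= => /negP/negbTE ->.
  rewrite integral_cst//= lebesgue_measure_itv/= lte_fin patchE /F /G !patchE.
  case: ifPn => xs; last by rewrite ltxx mule0.
  have := @g0 x; have := set_mem xs; rewrite /= in_itv/= => /andP[sx xT] /(_ sx xT).
  rewrite le_eqVlt => /predU1P[<-|->]; first by rewrite ltxx mule0 mul0r.
  by rewrite oppr0 adde0 -EFinM mulrC.
transitivity (\int[mu]_y \int[mu]_x h (x, y))%E.
  exact: (fubini_tonelli (T1 := measurableTypeR R) (T2 := measurableTypeR R)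
    (m1 := mu) (m2 := mu) h).
rewrite [RHS]integral_mkcond; apply: eq_integral => y _.
rewrite patchE; case: ifPn => [|]; last first.
  rewrite notin_setE/= in_itv/= andbT => /negP/negbTE y0.
  by apply: integral0_eq => x _; rewrite /h/= y0.
by rewrite inE/= in_itv/= andbT => /integral_h.
Qed.

End layer_cake.

(** By the layer cake formula it is enough to compare [f1] and [f2] on each superlevel set of [g].
    These sets are initial segments, where the last hypothesis applies. *)
Lemma le_integral_dominance (f1 f2 g : R -> R) :
  measurable_fun `[s, T] f1 -> measurable_fun `[s, T] f2 ->
  (forall x, s <= x -> x <= T -> 0 <= f1 x) ->
  (forall x, s <= x -> x <= T -> 0 <= f2 x) ->
  (forall x, s <= x -> x <= T -> 0 <= g x) ->
  (forall u v, s <= u -> u <= v -> v <= T -> g v <= g u) ->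
  (forall u, s <= u -> u <= T ->
    (\int[mu]_(x in `[s, u]) (f1 x)%:E <= \int[mu]_(x in `[s, u]) (f2 x)%:E)%E) ->
  (\int[mu]_(x in `[s, T]) (g x * f1 x)%:E <=
   \int[mu]_(x in `[s, T]) (g x * f2 x)%:E)%E.
Proof.
move=> mf1 mf2 f10 f20 g0 gni f12.
have mg : measurable_fun `[s, T] g by exact: nonincreasing_in_measurable.
rewrite !integral_layer_cake//; apply: ge0_le_integral => //.
- move=> y _; apply: integral_ge0 => x -[/andP[sx xT] _].
  by rewrite lee_fin f10.
- exact: measurable_integral_superlevel.
- exact: measurable_integral_superlevel.
move=> y _; rewrite /superlevel.
have [->|[u /andP[su uT] [->|->]]] := initial_segment y gni.
- by rewrite !integral_set0.
- exact: f12.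
(* A half-open segment differs from the closed one by a null set. *)
- rewrite !integral_itv_bndo_bndc; first exact: f12.
  + by apply/measurable_EFinP; apply: measurable_funS mf2 => //;
      apply: subset_itvl; rewrite bnd_simp.
  + by apply/measurable_EFinP; apply: measurable_funS mf1 => //;
      apply: subset_itvl; rewrite bnd_simp.
Qed.

End dominance.

(** * Integration against a measure with a density *)

Section density.
Local Open Scope ereal_scope.
Context d d' (X : measurableType d) (Y : measurableType d') (R : realType).
Variables (mu : {measure set X -> \bar R}) (m : {measure set Y -> \bar R}).
Variables (p : X -> Y) (D : set X) (U : set Y) (f : X -> R).
Hypothesis mp : measurable_fun setT p.
Hypothesis mD : measurable D.
Hypothesis mU : measurable U.
Hypothesis mf : measurable_fun D (EFin \o f).
Hypothesis f0 : forall x, D x -> (0 <= f x)%R.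
Hypothesis mE : forall A, measurable A -> A `<=` U ->
  m A = \int[mu]_(x in D `&` p @^-1` A) (f x)%:E.

Import HBNNSimple.

Let mpre A : measurable A -> measurable (p @^-1` A).
Proof. by move=> mA; rewrite -[X in measurable X]setTI; exact: mp. Qed.

Let DU := D `&` p @^-1` U.

Let mDU : measurable DU.
Proof. by apply: measurableI => //; exact: mpre. Qed.

Let mfDU : measurable_fun DU (EFin \o f).
Proof. exact: (measurable_funS mD (@subIsetl _ _ _) mf). Qed.

(** A simple function is a finite combination of indicators of its level sets, and on an indicator
    the claim is the hypothesis [mE]. *)
Let integral_density_nnsfun (g : {nnsfun Y >-> R}) :
  \int[m]_(y in U) (g y)%:E = \int[mu]_(x in DU) ((g (p x))%:E * (f x)%:E).
Proof.
have mg (r : R) : measurable (g @^-1` [set r]) by [].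
have ind0 r y : 0 <= (r * \1_(g @^-1` [set r]) y)%:E.
  by rewrite EFinM nnfun_muleindic_ge0.
have mind r : measurable_fun setT (fun y => (r * \1_(g @^-1` [set r]) y)%:E).
  exact/measurable_EFinP/measurableT_comp.
have mindf r : measurable_fun DU (fun x => (r * \1_(g @^-1` [set r]) (p x))%:E * (f x)%:E).
  apply: emeasurable_funM => //; apply: measurable_funTS.
  exact: (measurableT_comp (mind r)).
transitivity (\sum_(r \in range g)
    \int[m]_(y in U) (r * \1_(g @^-1` [set r]) y)%:E).
  under eq_integral do rewrite fimfunE -fsumEFin//.
  by rewrite ge0_integral_fsum// => r; exact: measurable_funTS.
transitivity (\sum_(r \in range g)
    \int[mu]_(x in DU) ((r * \1_(g @^-1` [set r]) (p x))%:E * (f x)%:E)); last first.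
  rewrite -ge0_integral_fsum//; last first.
    by move=> r x [Dx _]; rewrite mule_ge0// lee_fin f0.
  apply: eq_integral => x; rewrite inE => -[Dx _].
  by rewrite fimfunE -fsumEFin// ge0_mule_fsuml.
apply: eq_fsbigr => r _.
(* A negative [r] has an empty level set, so both integrals vanish. *)
have [r0|r0] := leP 0%R r; last first.
  by rewrite !integral0_eq// => x _; rewrite preimage_nnfun0// indic0 mulr0 ?mul0e.
under eq_integral do rewrite EFinM.
rewrite ge0_integralZl//; last by apply: measurable_funTS; exact/measurable_EFinP.
rewrite integral_indic// mE//; last by apply: measurableI.
under [RHS]eq_integral do rewrite EFinM -muleA.
rewrite ge0_integralZl//; last 2 first.
- apply: emeasurable_funM => //; apply: measurable_funTS.
  by apply/measurable_EFinP; apply: measurableT_comp => //; exact: measurable_indic.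
- by move=> x [Dx _]; rewrite mule_ge0 ?lee_fin ?f0.
congr (_ * _).
transitivity (\int[mu]_(x in DU `&` p @^-1` (g @^-1` [set r])) (f x)%:E).
  by congr (integral _ _ _); rewrite /DU preimage_setI setIAC setIA.
rewrite integral_mkcondr; apply: eq_integral => x _.
rewrite patchE indicE; case: ifPn => xr; first by rewrite mem_set ?mul1e//; exact: set_mem xr.
by rewrite memNset ?mul0e// => h; move/negP: xr; apply; exact: mem_set.
Qed.

(** Monotone convergence along simple approximations of [phi]. The density is only assumed on [U],
    so that the atom of a contact law at [+oo] can be left out. *)
Lemma ge0_integral_density (phi : Y -> \bar R) : (forall y, 0 <= phi y) ->
  measurable_fun setT phi ->
  \int[m]_(y in U) phi y = \int[mu]_(x in D `&` p @^-1` U) (phi (p x) * (f x)%:E).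
Proof.
move=> phi0 mphi; pose g := nnsfun_approx measurableT mphi.
have cg y : (g n y)%:E @[n --> \oo] --> phi y by exact: cvg_nnsfun_approx.
transitivity (\int[m]_(y in U) lim ((g n y)%:E @[n --> \oo])).
  by apply/eq_integral => y _; apply/esym/cvg_lim.
rewrite monotone_convergence//; last 3 first.
- by move=> n; apply: measurable_funTS; exact/measurable_EFinP.
- by move=> n y _; rewrite lee_fin.
- by move=> y _ a b ab; rewrite lee_fin; exact/lefP/nd_nnsfun_approx.
under eq_fun do rewrite integral_density_nnsfun.
rewrite -monotone_convergence//; last 3 first.
- move=> n; apply: emeasurable_funM => //; apply: measurable_funTS.
  by apply/measurable_EFinP; apply: measurableT_comp.
- by move=> n x [Dx _]; rewrite mule_ge0 ?lee_fin ?f0.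
- move=> x [Dx _] a b ab; rewrite lee_wpmul2r ?lee_fin ?f0//.
  exact/lefP/nd_nnsfun_approx.
apply: eq_integral => x; rewrite inE => -[Dx _].
by apply/cvg_lim => //; apply: cvgeZr.
Qed.

End density.

(** * Contact densities *)

Lemma EFin_Rintegral d (X : measurableType d) (R : realType)
    (m : {measure set X -> \bar R}) (D : set X) (f : X -> R) :
  measurable D -> m.-integrable D (EFin \o f) ->
  (Rintegral m D f)%:E = (\int[m]_(x in D) (f x)%:E)%E.
Proof. by move=> mD fi; rewrite /Rintegral fineK//; exact: integrable_fin_num. Qed.

Lemma le_Rintegral_EFin d (X : measurableType d) (R : realType)
    (m : {measure set X -> \bar R}) (D1 D2 : set X) (f1 f2 : X -> R) :
  measurable D1 -> measurable D2 ->
  m.-integrable D1 (EFin \o f1) -> m.-integrable D2 (EFin \o f2) ->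
  (\int[m]_(x in D1) (f1 x)%:E <= \int[m]_(x in D2) (f2 x)%:E)%E ->
  Rintegral m D1 f1 <= Rintegral m D2 f2.
Proof. by move=> mD1 mD2 i1 i2 f12; apply: fine_le => //; exact: integrable_fin_num. Qed.

Lemma EFin_Rintegral_itv (R : realType) (u v : R) (f : R -> R) :
  lebesgue_measure.-integrable `[u, v] (EFin \o f) ->
  (\int[lebesgue_measure]_(x in `[u, v]) f x)%:E =
  (\int[lebesgue_measure]_(x in `[u, v]) (f x)%:E)%E.
Proof. by move=> fi; exact: EFin_Rintegral. Qed.

Section rates.
Context {R : realType}.
Notation mu := (@lebesgue_measure R).
Variables (T B : R) (a : R -> R -> R).
Hypothesis a_bounds : forall s t : R, 0 <= s -> s <= t -> t <= T -> 0 <= a s t <= B.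
Hypothesis a_meas :
  measurable_fun [set x : R * R | [/\ 0 <= x.1, x.1 <= x.2 & x.2 <= T]]
    (fun x => a x.1 x.2).

Lemma contact_density_tail (s t : R) : 0 <= s -> s <= t -> t <= T ->
  \int[mu]_(x in `[t, T]) contact_density a s x =
  expR (- cumrate (a s) s t) - expR (- cumrate (a s) s T).
Proof.
move=> s0 st tT; have sT := le_trans st tT.
have di := contact_density_integrable a_bounds a_meas s0 (lexx s) (lexx T).
rewrite -Rintegral_itv_obnd_cbnd; last first.
  apply: (integrableS _ _ _ di) => //.
  by apply: subset_itv; rewrite ?bnd_simp.
rewrite -(@Rintegral_itvB _ _ (BLeft s) (BRight T) t) ?bnd_simp//.
by rewrite !(contact_density_integral a_bounds a_meas)//; ring.
Qed.

(** Integration by parts, done by Tonelli because the rate is only measurable. With [cumrate]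
    written as an integral of the rate, the second term becomes a double integral over
    [s <= y <= x <= T], which is evaluated in the other order. *)
Lemma contact_cost (s : R) : 0 <= s -> s <= T ->
  cumrate (a s) s T * expR (- cumrate (a s) s T) +
  \int[mu]_(x in `[s, T]) (cumrate (a s) s x * contact_density a s x) =
  \int[mu]_(x in `[s, T]) contact_density a s x.
Proof.
move=> s0 sT.
rewrite (contact_density_integral a_bounds a_meas)//.
set eT := expR (- cumrate (a s) s T).
have ai := rate_section_integrable a_bounds a_meas s0 (lexx s) (lexx T).
have di := contact_density_integrable a_bounds a_meas s0 (lexx s) (lexx T).
pose A := a s \_ `[s, T]; pose F := contact_density a s \_ `[s, T].
have mA : measurable_fun setT A.
  apply/(measurable_restrictT _ _).1 => //.
  exact: (rate_section_measurable a_meas).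
have mF : measurable_fun setT F.
  apply/(measurable_restrictT _ _).1 => //.
  exact: (contact_density_measurable a_bounds a_meas).
have A0 x : 0 <= A x.
  rewrite /A patchE; case: ifPn => // /set_mem/=; rewrite in_itv/= => /andP[sx xT].
  by have /andP[] := a_bounds s0 sx xT.
have F0 x : 0 <= F x.
  rewrite /F patchE; case: ifPn => // /set_mem/=; rewrite in_itv/= => /andP[sx xT].
  by have /andP[] := contact_density_bounds a_bounds a_meas s0 sx xT.
pose h (z : R * R) : \bar R := (if z.2 <= z.1 then A z.2 * F z.1 else 0)%:E.
have mh : measurable_fun setT h.
  apply/measurable_EFinP; apply: measurable_fun_ifT => //.
  - exact: measurable_fun_ler.
  - by apply: measurable_funM; exact: measurableT_comp.
have h0 z : (0 <= h z)%E by rewrite lee_fin; case: ifP => // _; exact: mulr_ge0.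
(* Integrating over the earlier time [y] first recovers the cumulative rate. *)
have E1 : (\int[mu]_(x in `[s, T]) (cumrate (a s) s x * contact_density a s x)%:E =
           \int[mu]_x \int[mu]_y h (x, y))%E.
  rewrite integral_mkcond; apply: eq_integral => x _; rewrite patchE /h/=.
  case: ifPn => [xs|xs]; last first.
    by rewrite integral0_eq// => y _; rewrite /F patchE (negbTE xs) mulr0 if_same.
  have := set_mem xs; rewrite /= in_itv/= => /andP[sx xT].
  have aix := rate_section_integrable a_bounds a_meas s0 (lexx s) xT.
  rewrite EFinM EFin_Rintegral// -integralZr//.
  rewrite integral_mkcond; apply: eq_integral => y _; rewrite patchE /A /F !patchE xs.
  case: ifPn => [|]; first rewrite inE/= in_itv/= => /andP[sy yx].
    by rewrite yx mem_set//= in_itv/= sy (le_trans yx).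
  rewrite notin_setE/= in_itv/= => /negP; rewrite negb_and => /orP[sy|/negbTE->//].
  by rewrite memNset ?mul0r ?if_same//= in_itv/= (negbTE sy).
(* Integrating over the later time [x] first gives the probability of a contact in [[y, T]], a
   difference of two survival probabilities. *)
have E2 : (\int[mu]_(y in `[s, T]) (contact_density a s y - eT * a s y)%:E =
           \int[mu]_y \int[mu]_x h (x, y))%E.
  rewrite integral_mkcond; apply: eq_integral => y _; rewrite patchE /h/=.
  case: ifPn => [ys|ys]; last first.
    by rewrite integral0_eq// => x _; rewrite /A patchE (negbTE ys) mul0r if_same.
  have := set_mem ys; rewrite /= in_itv/= => /andP[sy yT].
  have diy := contact_density_integrable a_bounds a_meas s0 sy (lexx T).
  transitivity ((a s y)%:E * \int[mu]_(x in `[y, T]) (contact_density a s x)%:E)%E.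
    rewrite -EFin_Rintegral// contact_density_tail// -EFinM; congr EFin.
    by rewrite /contact_density -/eT; ring.
  rewrite -integralZl// integral_mkcond; apply: eq_integral => x _.
  rewrite patchE /A /F !patchE ys.
  case: ifPn => [|]; first rewrite inE/= in_itv/= => /andP[yx xT].
    by rewrite yx mem_set//= in_itv/= (le_trans sy).
  rewrite notin_setE/= in_itv/= => /negP; rewrite negb_and => /orP[/negbTE->//|xT].
  by rewrite memNset ?mulr0 ?if_same//= in_itv/= (negbTE xT) andbF.
have -> : \int[mu]_(x in `[s, T]) (cumrate (a s) s x * contact_density a s x) =
    \int[mu]_(y in `[s, T]) (contact_density a s y - eT * a s y).
  apply: (congr1 fine); apply: (etrans E1); apply: (etrans _ (esym E2)).
  exact: (fubini_tonelli (T1 := measurableTypeR R) (T2 := measurableTypeR R)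
    (m1 := mu) (m2 := mu) h).
rewrite RintegralB//; last exact: (integrableZl _ _ ai).
rewrite RintegralZl// (contact_density_integral a_bounds a_meas)// -/eT.
by rewrite -[\int[mu]_(x in _) a s x]/(cumrate (a s) s T); ring.
Qed.

End rates.

(** * The full rate and the gain *)

(** Nonnegativity at a single time is the case [s = t]. *)
Definition nonneg_nonincreasing (R : realType) (T : R) (g : R -> R) :=
  forall s t, 0 <= s -> s <= t -> t <= T -> 0 <= g t <= g s.

Section best_response.
Context {R : realType} {G : game R} {i : 'I_(agents G)}.
Notation mu := (@lebesgue_measure R).
Notation T := (deadline G).
Notation B := (maxrate i).
Notation admissible_bounds a :=
  (forall s t : R, 0 <= s -> s <= t -> t <= T -> 0 <= a s t <= B).
Notation admissible_measurable a :=
  (measurable_fun [set x : R * R | [/\ 0 <= x.1, x.1 <= x.2 & x.2 <= T]]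
    (fun x => a x.1 x.2)).

(** It takes a starting time as well, so that the results on families of rate functions apply to
    it. *)
Definition full_rate (_ _ : R) : R := B.

Lemma full_rate_bounds : admissible_bounds full_rate.
Proof. by move=> s t _ _ _; rewrite /full_rate lexx (ltW (maxrate_gt0 i)). Qed.

Lemma full_rate_measurable : admissible_measurable full_rate.
Proof. exact: measurable_cst. Qed.

Lemma cumrate_full (s t : R) : s <= t -> cumrate (full_rate s) s t = B * (t - s).
Proof.
rewrite /cumrate /full_rate Rintegral_cst//.
have /= -> := @lebesgue_measure_itv R `[s, t].
by rewrite lte_fin le_eqVlt => /predU1P[->|->//]; rewrite ltxx subrr.
Qed.

Lemma integrable_density_mul (a : R -> R -> R) (g : R -> R) (s u v c : R) :
  admissible_bounds a -> admissible_measurable a ->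
  0 <= s -> s <= u -> v <= T -> measurable_fun `[u, v] g ->
  (forall x, u <= x -> x <= v -> `|g x| <= c) ->
  mu.-integrable `[u, v] (EFin \o (fun x => g x * contact_density a s x)).
Proof.
move=> ab am s0 su vT mg gc; apply: (integrable_bounded_itv (c := c * B)).
  by apply: measurable_funM => //; exact: (contact_density_measurable ab am).
move=> x ux xv; have /andP[d0 dB] := contact_density_bounds ab am s0 (le_trans su ux)
  (le_trans xv vT).
by rewrite normrM (ger0_norm d0) ler_pM// gc.
Qed.

Lemma nonneg_nonincreasing_measurable (g : R -> R) (s : R) : 0 <= s ->
  nonneg_nonincreasing T g -> measurable_fun `[s, T] g.
Proof.
move=> s0 gd; apply: nonincreasing_in_measurable => x y sx xy yT.
by have /andP[] := gd x y (le_trans s0 sx) xy yT.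
Qed.

Lemma nonneg_nonincreasing_bounded (g : R -> R) (x : R) :
  nonneg_nonincreasing T g -> 0 <= x -> x <= T -> `|g x| <= g 0.
Proof.
by move=> gd x0 xT; have /andP[g0 gx] := gd 0 x (lexx _) x0 xT; rewrite ger0_norm.
Qed.

(** The full rate makes the contact time stochastically smallest: the probability of a contact by
    time [u] increases with the cumulative rate. *)
Lemma le_integral_full_density (a : R -> R -> R) (s u : R) :
  admissible_bounds a -> admissible_measurable a -> 0 <= s -> s <= u -> u <= T ->
  \int[mu]_(x in `[s, u]) contact_density a s x <=
  \int[mu]_(x in `[s, u]) contact_density full_rate s x.
Proof.
move=> ab am s0 su uT.
have [fb fm] := (full_rate_bounds, full_rate_measurable).
rewrite (contact_density_integral ab am)// (contact_density_integral fb fm)//.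
rewrite lerD2l lerN2 ler_expR lerN2 /cumrate; apply: le_Rintegral => //.
- exact: (rate_section_integrable ab am).
- exact: (rate_section_integrable fb fm).
- move=> x /=; rewrite in_itv/= => /andP[sx xu].
  by have /andP[] := ab s x s0 sx (le_trans xu uT).
Qed.

Lemma le_integral_full_reward (a : R -> R -> R) (g : R -> R) (s : R) :
  admissible_bounds a -> admissible_measurable a -> nonneg_nonincreasing T g ->
  0 <= s -> s <= T ->
  \int[mu]_(x in `[s, T]) (g x * contact_density a s x) <=
  \int[mu]_(x in `[s, T]) (g x * contact_density full_rate s x).
Proof.
move=> ab am gd s0 sT.
have [fb fm] := (full_rate_bounds, full_rate_measurable).
have mg := nonneg_nonincreasing_measurable s0 gd.
have gc x : s <= x -> x <= T -> `|g x| <= g 0.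
  by move=> sx xT; rewrite nonneg_nonincreasing_bounded// (le_trans s0).
have i1 := integrable_density_mul ab am s0 (lexx s) (lexx T) mg gc.
have i2 := integrable_density_mul fb fm s0 (lexx s) (lexx T) mg gc.
apply: (le_Rintegral_EFin _ _ i1 i2); [exact: measurable_itv|exact: measurable_itv|].
apply: le_integral_dominance.
- exact: (contact_density_measurable ab am).
- exact: (contact_density_measurable fb fm).
- by move=> x sx xT; have /andP[] := contact_density_bounds ab am s0 sx xT.
- by move=> x sx xT; have /andP[] := contact_density_bounds fb fm s0 sx xT.
- by move=> x sx xT; have /andP[] := gd x x (le_trans s0 sx) (lexx _) xT.
- by move=> x y sx xy yT; have /andP[] := gd x y (le_trans s0 sx) xy yT.
- move=> u su uT; rewrite -(EFin_Rintegral_itv (contact_density_integrable ab am s0 (lexx s) uT)).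
  rewrite -(EFin_Rintegral_itv (contact_density_integrable fb fm s0 (lexx s) uT)).
  by rewrite lee_fin le_integral_full_density.
Qed.

(** The expected reward when a contact at time [x] pays [g x] and the full rate is used from time
    [s] on. *)
Definition full_value (g : R -> R) (s : R) : R :=
  \int[mu]_(x in `[s, T]) (g x * contact_density full_rate s x).

(** Starting later delays the contact, and a delayed contact earns less. The two starting times are
    compared by dominance on the longer interval [[s, T]]. *)
Lemma full_value_nonincreasing (g : R -> R) : nonneg_nonincreasing T g ->
  nonneg_nonincreasing T (full_value g).
Proof.
move=> gd s s' s0 ss' s'T; have s'0 := le_trans s0 ss'; have sT := le_trans ss' s'T.
have [fb fm] := (full_rate_bounds, full_rate_measurable).
have g0 x : 0 <= x -> x <= T -> 0 <= g x.
  by move=> x0 xT; have /andP[] := gd x x x0 (lexx _) xT.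
apply/andP; split.
  apply: Rintegral_ge0 => x /=; rewrite in_itv/= => /andP[sx xT].
  have x0 := le_trans s'0 sx.
  have /andP[d0 _] := contact_density_bounds fb fm s'0 sx xT.
  by rewrite mulr_ge0// g0.
have gc r x : 0 <= r -> r <= x -> x <= T -> `|g x| <= g 0.
  by move=> r0 rx xT; rewrite nonneg_nonincreasing_bounded// (le_trans r0).
have mg r : 0 <= r -> measurable_fun `[r, T] g.
  by move=> r0; exact: nonneg_nonincreasing_measurable.
have i1 := integrable_density_mul fb fm s'0 (lexx s') (lexx T) (mg s' s'0)
  (fun x => @gc s' x s'0).
have i2 := integrable_density_mul fb fm s0 (lexx s) (lexx T) (mg s s0)
  (fun x => @gc s x s0).
apply: (le_Rintegral_EFin _ _ i1 i2); [exact: measurable_itv|exact: measurable_itv|].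
(* The density of the later start is extended by zero, so that both densities live on [[s, T]]. *)
pose f := contact_density full_rate s' \_ `[s', T].
have fE x : s' <= x -> x <= T -> f x = contact_density full_rate s' x.
  by move=> sx xT; rewrite /f patchE mem_set//= in_itv/= sx.
have f0 x : 0 <= f x.
  rewrite /f patchE; case: ifPn => // /set_mem/=; rewrite in_itv/= => /andP[sx xT].
  by have /andP[] := contact_density_bounds fb fm s'0 sx xT.
have E (h : R -> R) u : u <= T -> (\int[mu]_(x in `[s, u]) (h x * f x)%:E =
    \int[mu]_(x in `[s', u]) (h x * contact_density full_rate s' x)%:E)%E.
  move=> uT; rewrite integral_mkcond [RHS]integral_mkcond; apply: eq_integral => x _.
  rewrite !patchE; case: ifPn => [|xs].
    rewrite inE/= in_itv/= => /andP[sx xu].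
    rewrite /f patchE; have xT := le_trans xu uT.
    have [s'x|xs'] := boolP (s' <= x); first by rewrite !mem_set//= in_itv/= s'x.
    by rewrite !memNset ?mulr0//= in_itv/= (negbTE xs').
  rewrite memNset// => /= H; move: xs; rewrite mem_set//.
  by move: H; rewrite /= !in_itv/= => /andP[s'x ->]; rewrite (le_trans ss').
rewrite -E//; apply: le_integral_dominance.
- apply: measurable_funTS; apply/(measurable_restrictT _ _).1 => //.
  exact: (contact_density_measurable fb fm).
- exact: (contact_density_measurable fb fm).
- by [].
- by move=> x sx xT; have /andP[] := contact_density_bounds fb fm s0 sx xT.
- by move=> x sx xT; rewrite g0// (le_trans s0).
- by move=> x y sx xy yT; have /andP[] := gd x y (le_trans s0 sx) xy yT.
- move=> u su uT.
  have := E (fun=> 1) u uT; under eq_integral do rewrite mul1r.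
  under [in X in _ = X -> _]eq_integral do rewrite mul1r.
  move=> ->.
  (* Before [s'] the later start has no mass. From [s'] on, the contact probabilities are
     [1 - exp (- B * (u - s'))] and [1 - exp (- B * (u - s))]. *)
  have [s'u|us'] := leP s' u; last first.
    have -> : `[s', u]%classic = set0 :> set R by rewrite set_itv_ge// bnd_simp -ltNge.
    rewrite integral_set0.
    apply: integral_ge0 => x /=; rewrite in_itv/= => /andP[sx xu]; rewrite lee_fin.
    by have /andP[] := contact_density_bounds fb fm s0 sx (le_trans xu uT).
  rewrite -(EFin_Rintegral_itv (contact_density_integrable fb fm s0 (lexx s) uT)).
  rewrite -(EFin_Rintegral_itv (contact_density_integrable fb fm s'0 (lexx s') uT)).
  rewrite lee_fin !(contact_density_integral fb fm)// !cumrate_full//.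
  rewrite lerD2l lerN2 ler_expR lerN2 ler_wpM2l ?(ltW (maxrate_gt0 i))//.
  by rewrite lerD2l lerN2.
Qed.

(** * Success probability, margin and gain of a contact *)

Variable piO : opponents i.

Lemma eta_nonincreasing (k : 'I_(locks G)) : nonneg_nonincreasing T (Defs.eta piO k).
Proof.
move=> s t s0 st tT; have t0 := le_trans s0 st.
have /andP[-> _] /= : 0 <= Defs.eta piO k t <= 1 by apply: eta_bounds; rewrite t0.
rewrite /Defs.eta; case: (k == lock1 (G := G)); last by [].
rewrite ler_expR lerN2; apply: ler_sum => m _.
have [ab am] := (rate_bounds (piO m) (lock1 (G:=G)) true,
  rate_measurable (piO m) (lock1 (G:=G)) true).
rewrite (cumrate_split ab am (lexx 0) s0 st tT) lerDl.
by have /andP[] := rate_increment_bounds ab am (lexx 0) s0 st tT.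
Qed.

(** The net expected payoff of a contact at time [t]: with probability [eta] it brings the reward
    and the continuation value [V t], and it costs the trade-off factor in any case. *)
Definition margin (k : 'I_(locks G)) (V : R -> R) (t : R) : R :=
  Defs.eta piO k t * (reward i k + V t) - tradeoff G.

Definition gain k V (t : R) : R := Num.max 0 (margin k V t).

(** Where the gain is positive, its margin is a product of two nonnegative nonincreasing factors
    minus a constant. *)
Lemma gain_nonincreasing k V : nonneg_nonincreasing T V ->
  nonneg_nonincreasing T (gain k V).
Proof.
move=> Vd s t s0 st tT; rewrite /gain le_max lexx/= ge_max !le_max lexx/=.
have [neg|pos] := lerP (margin k V t) 0; first by [].
rewrite /margin lerD2r; apply/orP; right.
have /andP[Vt Vts] := Vd s t s0 st tT.
have /andP[et ets] := eta_nonincreasing k s0 st tT.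
(* Rewards may be negative, but a positive margin at [t] excludes a negative [reward i k + V t]. *)
have cV : 0 <= reward i k + V t.
  rewrite leNgt; apply/negP => cV; move: pos; rewrite /margin ltNge => /negP; apply.
  rewrite subr_le0 (le_trans _ (ltW (tradeoff_gt0 G)))//.
  exact: (mulr_ge0_le0 et (ltW cV)).
by apply: (ler_pM et cV ets); rewrite lerD2l.
Qed.

Lemma margin_measurable k V (s : R) : 0 <= s -> nonneg_nonincreasing T V ->
  measurable_fun `[s, T] (margin k V).
Proof.
move=> s0 Vd; apply: measurable_funB => //; apply: measurable_funM.
  exact: nonneg_nonincreasing_measurable (eta_nonincreasing k).
by apply: measurable_funD => //; exact: nonneg_nonincreasing_measurable.
Qed.

Lemma margin_bounded k V (x : R) : nonneg_nonincreasing T V -> 0 <= x -> x <= T ->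
  `|margin k V x| <= `|reward i k| + V 0 + tradeoff G.
Proof.
move=> Vd x0 xT; apply: (le_trans (ler_normB _ _)).
rewrite (gtr0_norm (tradeoff_gt0 G)) lerD2r normrM.
have /andP[e0 e1] : 0 <= Defs.eta piO k x <= 1 by apply: eta_bounds; rewrite x0.
rewrite (ger0_norm e0) -[leRHS]mul1r; apply: (ler_pM e0 _ e1) => //.
rewrite (le_trans (ler_normD _ _))// lerD2l.
exact: nonneg_nonincreasing_bounded.
Qed.

(** By [contact_cost] the stage cost is [tradeoff G] times the probability of a contact, so it joins
    the reward under one integral. *)
Lemma stage_utilityE (pi : strategy i) k (s : R) : 0 <= s -> s < T ->
  stage_utility pi piO k (true, s%:E) =
  \int[mu]_(x in `[s, T])
    ((reward i k * Defs.eta piO k x - tradeoff G) * contact_density (rate pi k true) s x).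
Proof.
move=> s0 sT; rewrite /stage_utility/= /running/= lee_fin lte_fin s0 sT/=.
have [ab am] := (rate_bounds pi k true, rate_measurable pi k true).
set a := rate pi k true.
have di : mu.-integrable `[s, T] (EFin \o contact_density a s).
  exact: (contact_density_integrable ab am).
have ei : mu.-integrable `[s, T] (EFin \o (fun x => Defs.eta piO k x * contact_density a s x)).
  apply: (integrable_density_mul (c := 1) ab am) => //.
    exact: nonneg_nonincreasing_measurable (eta_nonincreasing k).
  move=> x sx xT; have /andP[e0 e1] : 0 <= Defs.eta piO k x <= 1.
    by apply: eta_bounds; rewrite (le_trans s0).
  by rewrite ger0_norm.
have -> : \int[mu]_(x in `[s, T]) (cumrate (a s) s x * expR (- cumrate (a s) s x) * a s x) =
    \int[mu]_(x in `[s, T]) (cumrate (a s) s x * contact_density a s x).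
  by apply: eq_Rintegral => x _; rewrite /contact_density -mulrA (mulrC (a s x)).
rewrite (contact_cost ab am)// ?(ltW sT)//.
have -> : \int[mu]_(x in `[s, T]) (Defs.eta piO k x * expR (- cumrate (a s) s x) * a s x) =
    \int[mu]_(x in `[s, T]) (Defs.eta piO k x * contact_density a s x).
  by apply: eq_Rintegral => x _; rewrite /contact_density -mulrA (mulrC (a s x)).
rewrite -!RintegralZl// -RintegralB//; last 2 first.
- exact: (integrableZl _ _ ei).
- exact: (integrableZl _ _ di).
by apply: eq_Rintegral => x _; rewrite mulrBl mulrA.
Qed.

End best_response.

(** * Integration against the contact and transition kernels *)

Lemma integral_kcomp_noparam d0 d1 d2 (X : measurableType d0) (Y : measurableType d1)
    (Z : measurableType d2) (R : realType) (l : R.-spker X ~> Y) (k : R.-spker Y ~> Z)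
    (x : X) (f : Z -> \bar R) :
  (forall z, 0 <= f z)%E -> measurable_fun setT f ->
  (\int[mkcomp_noparam l k x]_z f z = \int[l x]_y \int[k y]_z f z)%E.
Proof.
(* The second kernel is regarded as one that ignores an extra parameter. *)
move=> f0 mf; transitivity (\int[kcomp l (kernel.kernel_snd k) x]_z f z)%E.
  by apply: eq_measure_integral.
by rewrite integral_kcomp.
Qed.

Section kernels.
Context {R : realType} {G : game R} {i : 'I_(agents G)}.
Notation mu := (@lebesgue_measure R).
Notation T := (deadline G).
Notation B := (maxrate i).
Variables (pi : strategy i) (piO : opponents i) (k : 'I_(locks G)).

Let ab := rate_bounds pi k true.
Let am := rate_measurable pi k true.

(** The value 0 at [+oo] encodes that nothing is earned without a contact. *)
Definition extend_time (psi : R -> R) (t : \bar R) : \bar R :=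
  if (0 <= t <= T%:E)%E then (psi (fine t))%:E else 0%E.

Lemma extend_time_ge0 psi t : (forall x, 0 <= x -> x <= T -> 0 <= psi x) ->
  (0 <= extend_time psi t)%E.
Proof.
move=> psi0; rewrite /extend_time; case: ifPn => // /andP[].
by case: t => //= r; rewrite !lee_fin; exact: psi0.
Qed.

Lemma extend_timeE psi x : 0 <= x -> x <= T -> extend_time psi x%:E = (psi x)%:E.
Proof. by move=> x0 xT; rewrite /extend_time !lee_fin x0 xT. Qed.

Lemma extend_time_measurable psi : measurable_fun `[0, T] psi ->
  measurable_fun setT (extend_time psi).
Proof.
move=> mpsi.
rewrite (_ : extend_time psi = fun t : \bar R => if (0 <= t <= T%:E)%E then
    ((psi \_ `[0, T]) (fine t))%:E else 0%E); last first.
  apply/funext => t; rewrite /extend_time; case: ifPn => // /andP[].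
  case: t => //= r; rewrite !lee_fin => r0 rT.
  by rewrite patchE mem_set//= in_itv/= r0.
apply: measurable_fun_ifT => //.
  by apply: measurable_and; exact: measurable_fun_lee.
apply/measurable_EFinP; apply: measurableT_comp => //.
by apply/(measurable_restrictT _ _).1.
Qed.

Lemma integral_contact (psi : R -> R) (s : R) : 0 <= s -> s < T ->
  measurable_fun `[0, T] psi -> (forall x, 0 <= x -> x <= T -> 0 <= psi x) ->
  (\int[contact_kernel pi k (true, s%:E)]_t extend_time psi t =
   \int[mu]_(x in `[s, T]) (psi x * contact_density (rate pi k true) s x)%:E)%E.
Proof.
move=> s0 sT mpsi psi0.
pose U : set \bar R := ~` [set +oo%E].
have mU : measurable U by apply: measurableC; exact: emeasurable_set1.
have TU : `[s, T]%classic `&` EFin @^-1` U = `[s, T]%classic.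
  by apply/seteqP; split => x [].
(* The atom at [+oo] is dropped, as the integrand vanishes there; on finite times the contact law
   has a density. *)
transitivity (\int[contact_kernel pi k (true, s%:E)]_(t in U) extend_time psi t)%E.
  rewrite [RHS]integral_mkcond; apply: eq_integral => t _.
  rewrite patchE; case: ifPn => //; rewrite notin_setE/= => /contrapT ->.
  by rewrite /extend_time/= (leNgt +oo%E) ltry andbF.
rewrite (@ge0_integral_density _ _ _ _ _ mu _ EFin `[s, T]%classic U
    (contact_density (rate pi k true) s)).
- rewrite TU; apply: eq_integral => x; rewrite inE/= in_itv/= => /andP[sx xT].
  by rewrite extend_timeE ?EFinM// (le_trans s0).
- exact: EFin_measurable.
- by [].
- exact: mU.
- by apply/measurable_EFinP; exact: (contact_density_measurable ab am).
- move=> x /=; rewrite in_itv/= => /andP[sx xT].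
  by have /andP[] := contact_density_bounds ab am s0 sx xT.
- move=> A mA AU; rewrite /contact_kernel/= /contact /running/= lee_fin lte_fin s0 sT/=.
  rewrite /contact_law diracE memNset ?mule0 ?adde0//.
  by move=> /AU; apply.
- by move=> t; exact: extend_time_ge0.
- exact: extend_time_measurable.
Qed.

Lemma success_prob_bounds (t : \bar R) : 0 <= success_prob piO k t <= 1.
Proof.
rewrite /success_prob; case: ifPn => [|_]; last by rewrite ler01 lexx.
case: t => [r| |] /andP[t0 tT].
- by apply: eta_bounds; rewrite -!lee_fin t0.
- by move: tT; rewrite leNgt ltry.
- by move: t0; rewrite leNgt ltNy0.
Qed.

Lemma integral_transition (W : state R -> \bar R) z :
  (forall z', 0 <= W z')%E -> measurable_fun setT W ->
  (\int[transition pi piO k z]_z' W z' =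
   \int[contact_kernel pi k z]_t ((success_prob piO k t)%:E * W (z.1, t) +
     (1 - success_prob piO k t)%:E * W (false, t)))%E.
Proof.
move=> W0 mW; rewrite /transition integral_kcomp//; apply: eq_integral => t _.
rewrite integral_kcomp//.
transitivity (\int[bernoulli_prob (success_prob piO k t)]_b W (z.1 && b, t))%E.
  by apply: eq_integral => b _; rewrite integral_dirac// diracT mul1e.
by rewrite integral_bernoulli_prob ?success_prob_bounds//= andbT andbF.
Qed.

End kernels.

(** * One step of dynamic programming *)

Section bellman.
Context {R : realType} {G : game R} {i : 'I_(agents G)}.
Notation mu := (@lebesgue_measure R).
Notation T := (deadline G).
Notation B := (maxrate i).

(** A failure, or a time outside [[0, T]], ends all earnings. *)
Definition state_value (V : R -> R) (z : state R) : \bar R :=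
  if z.1 then extend_time (G := G) V z.2 else 0%E.

Lemma nonneg_nonincreasing_ge0 (V : R -> R) x : nonneg_nonincreasing T V ->
  0 <= x -> x <= T -> 0 <= V x.
Proof. by move=> Vd x0 xT; have /andP[] := Vd x x x0 (lexx _) xT. Qed.

Lemma state_value_ge0 V z : nonneg_nonincreasing T V -> (0 <= state_value V z)%E.
Proof.
move=> Vd; rewrite /state_value; case: ifP => // _.
by apply: extend_time_ge0 => x x0 xT; exact: nonneg_nonincreasing_ge0.
Qed.

Lemma state_value_le V z : nonneg_nonincreasing T V ->
  (state_value V z <= (V 0)%:E)%E.
Proof.
move=> Vd; have V0 : 0 <= V 0.
  by apply: nonneg_nonincreasing_ge0 => //; exact: ltW (deadline_gt0 G).
rewrite /state_value; case: ifP => _; last by rewrite lee_fin.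
rewrite /extend_time; case: ifPn => [|_]; last by rewrite lee_fin.
case: z => l [r| |] /andP[]; rewrite /= ?lee_fin.
- by move=> r0 rT; have /andP[] := Vd 0 r (lexx _) r0 rT.
- by move=> _; rewrite leNgt ltry.
- by rewrite leNgt ltNy0.
Qed.

Lemma state_value_measurable V : nonneg_nonincreasing T V ->
  measurable_fun setT (state_value V).
Proof.
move=> Vd; apply: measurable_fun_ifT => //.
apply: (measurableT_comp (extend_time_measurable _)); last exact: measurable_snd.
exact: nonneg_nonincreasing_measurable.
Qed.

Variables (pi : strategy i) (piO : opponents i) (k : 'I_(locks G)).
Let a := rate pi k true.
Let ab := rate_bounds pi k true.
Let am := rate_measurable pi k true.

Lemma integral_transition_value (V : R -> R) z : nonneg_nonincreasing T V ->
  (\int[transition pi piO k z]_z' state_value V z' =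
   if z.1 then \int[contact_kernel pi k z]_t
     extend_time (G := G) (fun x => Defs.eta piO k x * V x)%R t
   else 0)%E.
Proof.
move=> Vd; rewrite integral_transition; last 2 first.
- by move=> z'; exact: state_value_ge0.
- exact: state_value_measurable.
case: z => -[] tau /=; last first.
  by apply: integral0_eq => t _; rewrite /state_value/= !mule0 adde0.
apply: eq_integral => t _; rewrite /state_value/= mule0 adde0 /extend_time.
case: ifPn => t0T; last by rewrite mule0.
by rewrite /success_prob t0T -EFinM.
Qed.

Lemma integral_contact_idle z psi : ~~ running (G := G) z ->
  measurable_fun `[0, T] psi ->
  (\int[contact_kernel pi k z]_t extend_time (G := G) psi t = 0)%E.
Proof.
move=> nr mpsi; transitivity (\int[\d_(+oo%E : \bar R)]_t extend_time (G := G) psi t)%E.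
  apply: eq_measure_integral => A _ _.
  by rewrite /contact_kernel/= /contact (negbTE nr).
rewrite integral_dirac//; last exact: extend_time_measurable.
by rewrite /extend_time/= (leNgt +oo%E) ltry andbF mule0.
Qed.

Lemma running_time z : running (G := G) z -> exists s, [/\ 0 <= s, s < T & z.2 = s%:E].
Proof.
case: z => l [r| |] /andP[/= t0 tT].
- by exists r; rewrite -lee_fin -lte_fin.
- by move: tT; rewrite ltNge leey.
- by move: t0; rewrite leNgt ltNy0.
Qed.

Lemma full_value_deadline g : full_value (G := G) (i := i) g T = 0.
Proof. by rewrite /full_value set_itv1 Rintegral_set1. Qed.

(** After a failure or once the time has run out, nothing is earned now or later. *)
Lemma bellman_idle V g z : nonneg_nonincreasing T V -> ~~ (z.1 && running (G := G) z) ->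
  ((stage_utility pi piO k z)%:E + \int[transition pi piO k z]_z' state_value V z' =
   state_value (full_value (G := G) (i := i) g) z)%E.
Proof.
move=> Vd nz; rewrite integral_transition_value// /stage_utility (negbTE nz) add0e.
move: nz; rewrite /state_value; case: z => -[] tau //= nr.
rewrite integral_contact_idle//; last first.
  apply: measurable_funM; last exact: nonneg_nonincreasing_measurable.
  exact: nonneg_nonincreasing_measurable (eta_nonincreasing piO k).
(* Time [T] is not running although it lies in [[0, T]]; there [full_value] is an integral over one
   point, hence 0. *)
move: nr; rewrite /running/= /extend_time; case: ifPn => // /andP[t0 tT].
rewrite t0/= -leNgt => Tt; have -> : tau = T%:E by apply/eqP; rewrite eq_le tT.
by rewrite full_value_deadline.
Qed.

Lemma strategy_density_integrable (h : R -> R) c (s : R) : 0 <= s ->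
  measurable_fun `[s, T] h -> (forall x, s <= x -> x <= T -> `|h x| <= c) ->
  mu.-integrable `[s, T] (EFin \o (fun x => h x * contact_density a s x)).
Proof. by move=> s0 mh hc; exact: (integrable_density_mul ab am s0 (lexx s) (lexx T) mh hc). Qed.

(** The stage utility and the continuation value are integrals against the same contact density, and
    their integrands add up to the margin. *)
Lemma bellman_running V (s : R) : nonneg_nonincreasing T V -> 0 <= s -> s < T ->
  ((stage_utility pi piO k (true, s%:E))%:E +
    \int[transition pi piO k (true, s%:E)]_z' state_value V z' =
   (\int[mu]_(x in `[s, T]) (margin piO k V x * contact_density a s x))%:E)%E.
Proof.
move=> Vd s0 sT; rewrite integral_transition_value//=.
have me : measurable_fun `[0, T] (Defs.eta piO k).
  exact: nonneg_nonincreasing_measurable (eta_nonincreasing piO k).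
have mV : measurable_fun `[0, T] V by exact: nonneg_nonincreasing_measurable.
have sub : (`[s, T]%classic : set R) `<=` `[0, T]%classic.
  by apply: subset_itvr; rewrite bnd_simp.
have e01 x : 0 <= x -> x <= T -> 0 <= Defs.eta piO k x <= 1.
  by move=> x0 xT; apply: eta_bounds; rewrite x0.
rewrite integral_contact//; last 2 first.
- exact: measurable_funM.
- move=> x x0 xT; have /andP[e0 _] := e01 x x0 xT.
  exact: (mulr_ge0 e0 (nonneg_nonincreasing_ge0 Vd x0 xT)).
have i1 : mu.-integrable `[s, T]
    (EFin \o (fun x => (Defs.eta piO k x * V x) * contact_density a s x)).
  apply: (strategy_density_integrable (c := V 0) s0).
    apply: (@measurable_funS _ _ _ _ `[0, T]%classic) => //.
    exact: measurable_funM.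
  move=> x sx xT; have x0 := le_trans s0 sx; have /andP[e0 e1] := e01 x x0 xT.
  have /andP[v0 v1] := Vd 0 x (lexx _) x0 xT.
  rewrite ger0_norm ?mulr_ge0// -[leRHS]mul1r; exact: (ler_pM e0 v0 e1 v1).
have i2 : mu.-integrable `[s, T]
    (EFin \o (fun x => (reward i k * Defs.eta piO k x - tradeoff G) * contact_density a s x)).
  apply: (strategy_density_integrable (c := `|reward i k| + tradeoff G) s0).
    apply: (@measurable_funS _ _ _ _ `[0, T]%classic) => //.
    by apply: measurable_funB => //; exact: measurable_funM.
  move=> x sx xT; have x0 := le_trans s0 sx; have /andP[e0 e1] := e01 x x0 xT.
  apply: (le_trans (ler_normB _ _)); rewrite (gtr0_norm (tradeoff_gt0 G)) lerD2r.
  by rewrite normrM (ger0_norm e0) ler_piMr.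
rewrite stage_utilityE// -(EFin_Rintegral_itv i1) -EFinD; congr EFin.
rewrite -(RintegralD _ i2 i1)//.
by apply: eq_Rintegral => x _; rewrite /margin -mulrDl; congr (_ * _); ring.
Qed.

Lemma margin_density_integrable V (s : R) : nonneg_nonincreasing T V -> 0 <= s ->
  mu.-integrable `[s, T] (EFin \o (fun x => margin piO k V x * contact_density a s x)).
Proof.
move=> Vd s0; apply: (strategy_density_integrable s0 (margin_measurable piO k s0 Vd)) => x sx xT.
exact: (margin_bounded piO k Vd (le_trans s0 sx) xT).
Qed.

(** The margin is at most the gain, and the gain, being nonincreasing, is best collected at the full
    rate. *)
Lemma bellman_le V z : nonneg_nonincreasing T V ->
  ((stage_utility pi piO k z)%:E + \int[transition pi piO k z]_z' state_value V z' <=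
   state_value (full_value (i := i) (gain piO k V)) z)%E.
Proof.
move=> Vd; have [/andP[z1 zr]|nz] := boolP (z.1 && running (G := G) z); last first.
  by rewrite (bellman_idle (gain piO k V)).
have [s [s0 sT z2]] := running_time zr.
have -> : z = (true, s%:E) by rewrite (surjective_pairing z) z1 z2.
rewrite (bellman_running Vd s0 sT) /state_value/= (extend_timeE _ s0 (ltW sT)) lee_fin.
have gd := gain_nonincreasing piO k Vd.
apply: le_trans (le_integral_full_reward ab am gd s0 (ltW sT)).
apply: le_Rintegral.
- exact: measurable_itv.
- exact: margin_density_integrable.
- apply: (strategy_density_integrable (c := gain piO k V 0) s0).
    exact: nonneg_nonincreasing_measurable.
  by move=> x sx xT; exact: (nonneg_nonincreasing_bounded gd (le_trans s0 sx) xT).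
- move=> x /=; rewrite in_itv/= => /andP[sx xT].
  have /andP[d0 _] := contact_density_bounds ab am s0 sx xT.
  by apply: (ler_wpM2r d0); rewrite /gain le_max lexx orbT.
Qed.

(** Both integrands agree off [theta]. Before it the margin equals the gain and the rate is full;
    after it the gain and the rate are both zero. *)
Lemma bellman_eq V z theta : nonneg_nonincreasing T V ->
  (forall x, 0 <= x -> x < theta -> 0 <= margin piO k V x) ->
  (forall x, 0 <= x -> theta < x -> x <= T -> margin piO k V x <= 0) ->
  (forall s t, 0 <= s -> s <= t -> t <= T -> a s t = threshold_policy (i := i) theta t) ->
  ((stage_utility pi piO k z)%:E + \int[transition pi piO k z]_z' state_value V z' =
   state_value (full_value (i := i) (gain piO k V)) z)%E.
Proof.
move=> Vd mlt mgt aE.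
have [/andP[z1 zr]|nz] := boolP (z.1 && running (G := G) z); last first.
  exact: bellman_idle.
have [s [s0 sT z2]] := running_time zr.
have -> : z = (true, s%:E) by rewrite (surjective_pairing z) z1 z2.
rewrite (bellman_running Vd s0 sT) /state_value/= (extend_timeE _ s0 (ltW sT)).
apply: (congr1 EFin); apply: (congr1 fine).
have [fb fm] := (full_rate_bounds (i := i), full_rate_measurable (i := i)).
have gd := gain_nonincreasing piO k Vd.
apply: ae_eq_integral.
- exact: measurable_itv.
- exact: (measurable_int mu (margin_density_integrable Vd s0)).
- apply/measurable_EFinP; apply: measurable_funM.
    exact: nonneg_nonincreasing_measurable.
  exact: (contact_density_measurable fb fm).
(* The sign of the margin at [theta] itself is not known, but one point is a null set. *)
exists [set theta]; split => //; first exact: lebesgue_measure_set1.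
move=> x /= /not_implyP[]; rewrite in_itv/= => /andP[sx xT]; apply: contra_notP => xt.
have x0 := le_trans s0 sx.
apply: (congr1 EFin); have [xlt|xgt] : x < theta \/ theta < x.
- by move/eqP: xt; rewrite neq_lt => /orP.
- rewrite /gain (max_idPr (mlt x x0 xlt)); congr (_ * _).
  (* The density at [x] depends on the rate over all of [[s, x]], which lies before [theta]. *)
  have aB y : s <= y -> y <= x -> a s y = full_rate (i := i) s y.
    move=> sy yx; rewrite aE ?(le_trans yx)//.
    by rewrite /threshold_policy /full_rate (le_trans yx (ltW xlt)).
  rewrite /contact_density aB//; congr (_ * expR (- _)).
  by apply: eq_Rintegral => y; rewrite inE/= in_itv/= => /andP[sy yx]; rewrite aB.
- rewrite /gain (max_idPl (mgt x x0 xgt xT)) mul0r /contact_density aE//.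
  by rewrite /threshold_policy leNgt xgt/= mul0r mulr0.
Qed.

End bellman.

(** * Backward induction *)

Section optimality.
Context {R : realType} {G : game R} {i : 'I_(agents G)}.
Notation mu := (@lebesgue_measure R).
Notation T := (deadline G).
Variables (piO : opponents i).

(** * Measurability and boundedness of the stage utility *)

Section stage_utility.
Variables (pi : strategy i) (k : 'I_(locks G)).

Let mean_contact psi z : R :=
  fine (\int[contact_kernel pi k z]_t extend_time (G := G) psi t)%E.

Let me : measurable_fun `[0, T] (Defs.eta piO k).
Proof. exact: nonneg_nonincreasing_measurable (eta_nonincreasing piO k). Qed.

Let e01 x : 0 <= x -> x <= T -> 0 <= Defs.eta piO k x <= 1.
Proof. by move=> x0 xT; apply: eta_bounds; rewrite x0. Qed.

Let mean_contact_measurable (psi : R -> R) : measurable_fun `[0, T] psi ->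
  (forall x, 0 <= x -> x <= T -> 0 <= psi x <= 1) ->
  measurable_fun setT (mean_contact psi).
Proof.
move=> mpsi psi01; apply: measurableT_comp => //.
apply: measurable_fun_integral_kernel.
- by move=> U mU; exact: measurable_kernel.
- by move=> t; apply: extend_time_ge0 => x x0 xT; have /andP[] := psi01 x x0 xT.
- exact: extend_time_measurable.
Qed.

Let mean_contact_bounds (psi : R -> R) z : measurable_fun `[0, T] psi ->
  (forall x, 0 <= x -> x <= T -> 0 <= psi x <= 1) ->
  0 <= mean_contact psi z <= 1.
Proof.
move=> mpsi psi01.
have p0 t : (0 <= extend_time (G := G) psi t)%E.
  by apply: extend_time_ge0 => x x0 xT; have /andP[] := psi01 x x0 xT.
have I0 : (0 <= \int[contact_kernel pi k z]_t extend_time (G := G) psi t)%E.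
  exact: integral_ge0.
have I1 : (\int[contact_kernel pi k z]_t extend_time (G := G) psi t <= 1)%E.
  have <- : (\int[contact_kernel pi k z]_t (cst 1 t) = 1)%E.
    by rewrite integral_cst// mul1e prob_kernel.
  apply: ge0_le_integral => //; first exact: extend_time_measurable.
  move=> t _; rewrite /extend_time; case: ifPn => [|_]; last exact: lee01.
  case: t => [r| |] /andP[]; rewrite ?lee_fin/=.
  - by move=> r0 rT; have /andP[] := psi01 r r0 rT.
  - by move=> _; rewrite leNgt ltry.
  - by rewrite leNgt ltNy0.
rewrite /mean_contact fine_ge0//= -lee_fin fineK// ge0_fin_numE//.
exact: (le_lt_trans I1 (ltry 1)).
Qed.

(** Written with expectations under the contact kernel, the stage utility is measurable in the state
    because the kernel is, and bounded because the expectations lie between 0 and 1. *)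
Let stage_utility_mean z : stage_utility pi piO k z =
  if z.1 && running (G := G) z then
    reward i k * mean_contact (Defs.eta piO k) z - tradeoff G * mean_contact (fun=> 1) z
  else 0.
Proof.
case: ifPn => [/andP[z1 zr]|/negbTE nz]; last by rewrite /stage_utility nz.
have [s [s0 sT z2]] := running_time zr.
have -> : z = (true, s%:E) by rewrite (surjective_pairing z) z1 z2.
rewrite (stage_utilityE piO pi k s0 sT) /mean_contact.
rewrite (integral_contact pi k s0 sT me); last first.
  by move=> x x0 xT; have /andP[] := e01 x0 xT.
rewrite (integral_contact pi k s0 sT)//.
have sub : (`[s, T]%classic : set R) `<=` `[0, T]%classic.
  by apply: subset_itvr; rewrite bnd_simp.
have ei : mu.-integrable `[s, T]
    (EFin \o (fun x => Defs.eta piO k x * contact_density (rate pi k true) s x)).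
  apply: (strategy_density_integrable (c := 1) pi k s0).
    exact: measurable_funS me.
  move=> x sx xT; have /andP[e0 e1] := e01 (le_trans s0 sx) xT.
  by rewrite ger0_norm.
have di : mu.-integrable `[s, T]
    (EFin \o (fun x => 1 * contact_density (rate pi k true) s x)).
  apply: (strategy_density_integrable (c := 1) pi k s0) => // x _ _.
  by rewrite normr1.
rewrite -[fine (integral _ _ _)]/(Rintegral _ _ _) -[X in _ = _ - _ * X]/(Rintegral _ _ _).
rewrite -(RintegralZl _ _ ei)// -(RintegralZl _ _ di)// -RintegralB//; last 2 first.
- exact: (integrableZl _ _ ei).
- exact: (integrableZl _ _ di).
by apply: eq_Rintegral => x _; rewrite mul1r mulrBl mulrA.
Qed.

Lemma stage_utility_measurable : measurable_fun setT (stage_utility pi piO k).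
Proof.
have /funext -> := stage_utility_mean.
apply: measurable_fun_ifT => //.
- apply: measurable_and; first exact: measurable_fst.
  by apply: measurable_and; [exact: measurable_fun_lee|exact: measurable_fun_lte].
- apply: measurable_funB; apply: measurable_funM => //.
  + by apply: mean_contact_measurable => // x; exact: e01.
  + by apply: mean_contact_measurable => // x _ _; rewrite ler01 lexx.
Qed.

Lemma stage_utility_bounded z :
  `|stage_utility pi piO k z| <= `|reward i k| + tradeoff G.
Proof.
rewrite stage_utility_mean; have nu0 := ltW (tradeoff_gt0 G).
case: ifPn => _; last by rewrite normr0 addr_ge0.
have /andP[a0 a1] := mean_contact_bounds z me e01.
have /andP[b0 b1] : 0 <= mean_contact (fun=> 1) z <= 1.
  by apply: mean_contact_bounds => // x _ _; rewrite ler01 lexx.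
apply: (le_trans (ler_normB _ _)); apply: lerD.
- by rewrite normrM (ger0_norm a0) ler_piMr.
- by rewrite normrM (ger0_norm b0) (ger0_norm nu0) ler_piMr.
Qed.

End stage_utility.

(* [d] is the number of locks still to be acquired. *)
Fixpoint value_to_go (d : nat) : R -> R :=
  if d is d'.+1 then
    if insub (locks G - d)%N is Some k then full_value (i := i) (gain piO k (value_to_go d'))
    else fun=> 0
  else fun=> 0.

(** The value before the lock of index [n], indices starting at 0; it is zero once all locks are
    done. *)
Definition value (n : nat) : R -> R := value_to_go (locks G - n).

Lemma nonneg_nonincreasing0 : nonneg_nonincreasing T (fun=> 0).
Proof. by move=> s t _ _ _; rewrite lexx. Qed.

Lemma value_nonincreasing n : nonneg_nonincreasing T (value n).
Proof.
rewrite /value; elim: (locks G - n)%N => /= [|d IH]; first exact: nonneg_nonincreasing0.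
case: insubP => [k _ _|_]; last exact: nonneg_nonincreasing0.
by apply: full_value_nonincreasing; exact: gain_nonincreasing.
Qed.

Lemma valueE (k : 'I_(locks G)) : value k = full_value (i := i) (gain piO k (value k.+1)).
Proof.
rewrite /value subnS.
(* The recursion computes its lock index as [locks G - (locks G - k)], which [subKn] turns back into
   [k]. *)
case: (locks G - k)%N (subn_gt0 k (locks G)) (subKn (ltnW (ltn_ord k))) => [|d].
  by rewrite ltn_ord.
by move=> _ /= ->; rewrite valK.
Qed.

Lemma value_locks : value (locks G) = fun=> 0.
Proof. by rewrite /value subnn. Qed.

(** * Expected values along the chain of states *)

Section chain.
Variable pi : strategy i.
Let z0 : state R := (true, 0%:E).

Let chain_integrable n (f : state R -> R) c : measurable_fun setT f ->
  (forall z, `|f z| <= c) -> (chain pi piO n z0).-integrable setT (EFin \o f).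
Proof.
move=> mf fc; apply: measurable_bounded_integrable => //.
  by rewrite chainT ltry.
exists c; split; first exact: num_real.
by move=> M cM x _ /=; exact: (le_trans (fc x) (ltW cM)).
Qed.

Definition chain_value n : R :=
  fine (\int[chain pi piO n z0]_z state_value (G := G) (value n) z)%E.

Let state_value_fin V z : nonneg_nonincreasing T V -> state_value (G := G) V z \is a fin_num.
Proof.
move=> Vd; rewrite ge0_fin_numE; last exact: state_value_ge0.
exact: (le_lt_trans (state_value_le z Vd) (ltry _)).
Qed.

Let state_value_integrable n V : nonneg_nonincreasing T V ->
  (chain pi piO n z0).-integrable setT (state_value (G := G) V).
Proof.
move=> Vd; rewrite (_ : state_value V = EFin \o (fine \o state_value (G := G) V)); last first.
  by apply/funext => z /=; rewrite fineK// state_value_fin.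
apply: (@chain_integrable _ _ (V 0)).
  by apply: measurableT_comp => //; exact: state_value_measurable.
move=> z /=; rewrite ger0_norm ?fine_ge0 ?state_value_ge0//.
by rewrite -lee_fin fineK ?state_value_fin// state_value_le.
Qed.

Let chain_valueE n :
  (\int[chain pi piO n z0]_z state_value (G := G) (value n) z)%E = (chain_value n)%:E.
Proof.
rewrite /chain_value fineK//; apply: integrable_fin_num => //.
exact: state_value_integrable (value_nonincreasing n).
Qed.

Let transition_value_ge0 (k : 'I_(locks G)) V z : nonneg_nonincreasing T V ->
  (0 <= \int[transition pi piO k z]_z' state_value (G := G) V z')%E.
Proof. by move=> Vd; apply: integral_ge0 => z' _; exact: state_value_ge0. Qed.

Let transition_value_integrable (k : 'I_(locks G)) V : nonneg_nonincreasing T V ->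
  (chain pi piO k z0).-integrable setT
    (fun z => \int[transition pi piO k z]_z' state_value (G := G) V z')%E.
Proof.
move=> Vd.
have le z : (\int[transition pi piO k z]_z' state_value (G := G) V z' <= (V 0)%:E)%E.
  have <- : (\int[transition pi piO k z]_z' (cst (V 0)%:E z') = (V 0)%:E)%E.
    by rewrite integral_cst// prob_kernel mule1.
  apply: ge0_le_integral => //.
  - by move=> z' _; exact: state_value_ge0.
  - exact: state_value_measurable.
  - by move=> z' _; exact: state_value_le.
have fin z : (\int[transition pi piO k z]_z' state_value (G := G) V z')%E \is a fin_num.
  rewrite ge0_fin_numE; last exact: transition_value_ge0.
  exact: (le_lt_trans (le z) (ltry _)).
pose h z := fine (\int[transition pi piO k z]_z' state_value (G := G) V z')%E.
have -> : (fun z => \int[transition pi piO k z]_z' state_value (G := G) V z')%E = EFin \o h.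
  by apply/funext => z; exact: esym (fineK (fin z)).
apply: (@chain_integrable _ _ (V 0)).
  rewrite /h; apply: (@measurableT_comp _ _ _ _ _ _ fine) => //.
  apply: measurable_fun_integral_kernel.
  - by move=> U mU; exact: measurable_kernel.
  - by move=> z'; exact: state_value_ge0.
  - exact: state_value_measurable.
move=> z; rewrite /h ger0_norm ?fine_ge0 ?transition_value_ge0//.
by rewrite -lee_fin fineK.
Qed.

Let stage_utility_integrable (k : 'I_(locks G)) :
  (chain pi piO k z0).-integrable setT (EFin \o stage_utility pi piO k).
Proof.
apply: (@chain_integrable _ _ (`|reward i k| + tradeoff G)).
  exact: stage_utility_measurable.
exact: stage_utility_bounded.
Qed.

Definition stage_mean (k : 'I_(locks G)) : R :=
  Rintegral (chain pi piO k z0) setT (stage_utility pi piO k).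

(** Averaging the Bellman expression over the state at lock [k]; one more transition turns the
    continuation term into the expectation at the next epoch. *)
Let chain_step (k : 'I_(locks G)) :
  (\int[chain pi piO k z0]_z ((stage_utility pi piO k z)%:E +
     \int[transition pi piO k z]_z' state_value (G := G) (value k.+1) z') =
   (stage_mean k + chain_value k.+1)%:E)%E.
Proof.
have Vd := value_nonincreasing k.+1.
rewrite integralD//; last exact: transition_value_integrable.
rewrite EFinD -chain_valueE /stage_mean (EFin_Rintegral _ (stage_utility_integrable k))//.
congr (_ + _)%E; rewrite /= valK integral_kcomp_noparam//.
- by move=> z; exact: state_value_ge0.
- exact: state_value_measurable.
Qed.

Lemma utilityE : utility pi piO = (\sum_(k < locks G) stage_mean k)%:E.
Proof.
rewrite /utility -sumEFin; apply: eq_bigr => k _.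
by rewrite /stage_mean (EFin_Rintegral _ (stage_utility_integrable k)).
Qed.

Lemma stage_mean_le (k : 'I_(locks G)) :
  stage_mean k <= chain_value k - chain_value k.+1.
Proof.
rewrite lerBrDr -lee_fin -chain_step -chain_valueE.
have Vd := value_nonincreasing k.+1.
apply: le_integral => //.
- by apply: integrableD => //; exact: transition_value_integrable.
- exact: state_value_integrable (value_nonincreasing k).
- by move=> z _; rewrite valueE; exact: bellman_le.
Qed.

(** A telescoping sum: the chain starts at a Dirac mass in [(true, 0)], and the value after the last
    lock is zero. *)
Lemma chain_value_sum :
  \sum_(k < locks G) (chain_value k - chain_value k.+1) = value 0 0.
Proof.
have -> : value 0 0 = chain_value 0.
  rewrite /chain_value /= /kdirac integral_dirac//; last first.
    exact: state_value_measurable (value_nonincreasing 0).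
  rewrite diracT mul1e /state_value/= extend_timeE//.
  exact: ltW (deadline_gt0 G).
have E : chain_value (locks G) = 0.
  rewrite /chain_value value_locks integral0_eq// => z _.
  by rewrite /state_value /extend_time; case: z.1 => //; case: ifP.
rewrite -(big_mkord xpredT (fun k => chain_value k - chain_value k.+1)).
under eq_bigr do rewrite -opprB.
by rewrite sumrN telescope_sumr// E sub0r opprK.
Qed.

Lemma utility_le : (utility pi piO <= (value 0 0)%:E)%E.
Proof.
rewrite utilityE lee_fin -chain_value_sum; apply: ler_sum => k _.
exact: stage_mean_le.
Qed.

Definition separates (theta : R) (k : 'I_(locks G)) :=
  (forall x, 0 <= x -> x < theta -> 0 <= margin piO k (value k.+1) x) /\
  (forall x, 0 <= x -> theta < x -> x <= T -> margin piO k (value k.+1) x <= 0).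

(** Every step of the Bellman comparison is an equality, so the upper bound for all strategies is
    attained. *)
Lemma utility_MT (theta : 'I_(locks G) -> R) : is_MT_strategy theta pi ->
  (forall k, separates (theta k) k) -> utility pi piO = (value 0 0)%:E.
Proof.
move=> [_ piE] sep; rewrite utilityE -chain_value_sum; congr EFin.
apply: eq_bigr => k _; apply/eqP; rewrite eq_sym subr_eq -eqe -chain_step -chain_valueE.
apply/eqP; have [mlt mgt] := sep k; have Vd := value_nonincreasing k.+1.
apply: eq_integral => z _; rewrite valueE.
apply/esym; apply: (bellman_eq z Vd mlt mgt) => s t s0 st tT.
by have [] := piE k s t s0 st tT.
Qed.

End chain.

(** * Thresholds where the margin changes sign, and their strategy *)

Definition threshold (k : 'I_(locks G)) : R :=
  sup [set t | 0 <= t <= T /\ 0 < margin piO k (value k.+1) t].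

Lemma threshold_bounds k : 0 <= threshold k <= T.
Proof.
rewrite /threshold; set A := [set t | _].
(* If the margin is never positive, the supremum takes its default value 0, a legitimate
   threshold. *)
have [->|/set0P[t At]] := eqVneq A set0; first by rewrite sup0 lexx (ltW (deadline_gt0 G)).
have ubT : ubound A T by move=> x [/andP[]].
apply/andP; split; last by apply: sup_le_ub => //; exists t.
have [/andP[t0 _] _] := At; apply: (le_trans t0); apply: ub_le_sup => //.
by exists T.
Qed.

Lemma threshold_separates k : separates (threshold k) k.
Proof.
have Vd := value_nonincreasing k.+1.
rewrite /separates /threshold; set A := [set t | _].
have ubT : ubound A T by move=> x [/andP[]].
split=> [x x0|x x0].
  have [->|/set0P A0] := eqVneq A set0; first by rewrite sup0 ltNge x0.
  move=> xA; have [y [/andP[y0 yT] my] xy] := sup_gt A0 xA.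
  (* A positive margin at the later time [y] makes the gain positive at [x], hence also the margin,
     although the margin itself need not be monotone. *)
  have /andP[_] := gain_nonincreasing piO k Vd x0 (ltW xy) yT.
  rewrite {1}/gain (max_idPr (ltW my)) => /(lt_le_trans my).
  by rewrite /gain lt_max ltxx => /ltW.
move=> Ax xT; rewrite leNgt; apply/negP => mx.
have : x <= sup A.
  by apply: ub_le_sup; [exists T|split => //; rewrite x0].
by rewrite leNgt Ax.
Qed.

Section threshold_strategy.
Variable theta : 'I_(locks G) -> R.

Let MT_rate (k : 'I_(locks G)) (l : bool) (s t : R) : R :=
  if l then threshold_policy (i := i) (theta k) t else 0.

Let MT_rate_bounds k l (s t : R) : 0 <= s -> s <= t -> t <= T ->
  0 <= MT_rate k l s t <= maxrate i.
Proof.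
move=> _ _ _; have B0 := ltW (maxrate_gt0 i).
rewrite /MT_rate /threshold_policy; case: l; last by rewrite lexx.
by case: ifP => _; rewrite ?lexx B0.
Qed.

Let MT_rate_measurable k l :
  measurable_fun [set x : R * R | [/\ 0 <= x.1, x.1 <= x.2 & x.2 <= T]]
    (fun x => MT_rate k l x.1 x.2).
Proof.
apply: measurable_funTS; rewrite /MT_rate /threshold_policy; case: l => //.
by apply: measurable_fun_ifT => //; exact: measurable_fun_ler.
Qed.

Definition MT_strategy : strategy i := Strategy MT_rate_bounds MT_rate_measurable.

Lemma MT_strategyP : (forall k, 0 <= theta k <= T) -> is_MT_strategy theta MT_strategy.
Proof. by []. Qed.

End threshold_strategy.

End optimality.

Theorem theorem2 (R : realType) (G : game R) (i : 'I_(agents G))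
    (piO : opponents i) :
  exists (theta : 'I_(locks G) -> R) (pistar : strategy i),
    is_MT_strategy theta pistar /\
    utility pistar piO = ereal_sup [set utility pi piO | pi in [set: strategy i]].
Proof.
have MT := MT_strategyP (i := i) (threshold_bounds piO).
exists (threshold piO), (MT_strategy (threshold piO)); split; first exact: MT.
apply/eqP; rewrite eq_le; apply/andP; split.
  by apply: ereal_sup_ubound; exists (MT_strategy (threshold piO)).
(* The threshold strategy earns exactly [value 0 0], which bounds the utility of every strategy. *)
rewrite (utility_MT MT (threshold_separates piO)).
by apply: ub_ereal_sup => _ [pi _ <-]; exact: utility_le.
Qed.
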